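(* Let $n\ge3$ be an odd integer. Consider the differential system $$p_1'=\prod_{j\ne1}p_j\prod_{2\le i<j\le n}(p_i^2-p_j^2),\quad\text{and its cyclic analogues for } p_2',\dots,p_n',\qquad \sigma_\ell(p_1^2,\dots,p_n^2)=\xi_\ell,\quad 1\le\ell\le n-1,$$ with $\xi_\ell$, $1\le\ell\le n-1$, fixed and forming an admissible collection. Define $$H(Z)=Z^n-\xi_1Z^{n-1}+\xi_2Z^{n-2}-\cdots+\xi_{n-1}Z$$ and the $n$th degree polynomial $$\mathscr{D}_n(\mathfrak{x})=4\mathfrak{x}\cdot\mathrm{discrim}_Z\big(H(Z)-\mathfrak{x}\big).$$ Let $\Upsilon(t)$ be the hyper-elliptic function such that $\Upsilon'^2=\mathscr{D}_n(\Upsilon)$, which is of generic genus $\frac{n-1}{2}$. Let $P_j=P_j(t)$, $1\le j\le n$, be the $n$ solutions of the algebraic equation $H(X)=\Upsilon(t)$. Then the functions $p_j$ given by $p_j^2=P_j$, with the correct choices of signs, solve the differential system consisting of $p_1'=\prod_{j\ne1}p_j\prod_{2\le i<j\le n}(p_i^2-p_j^2)$, its cyclic analogues for $p_2',\dots,p_n'$, and $\sigma_\ell(p_1^2,\dots,p_n^2)=\xi_\ell$ for $1\le\ell\le n-1$.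
   Context: $\sigma_\ell$ is the $\ell$th elementary symmetric polynomial. The cyclic analogues are obtained as follows: with $\varpi_1(x_1,\dots,x_n)=\prod_{j=2}^n x_j\prod_{2\le i<j\le n}(x_i^2-x_j^2)$, the equation for $p_k$ is $p_k'=\varpi_1(p_k,p_{k+1},\dots,p_n,p_1,\dots,p_{k-1})$. The collection $(\xi_1,\dots,\xi_{n-1})$ is admissible if it corresponds to a genuine orbit, i.e. there is a real point $(x_1,\dots,x_n)$ with $\sigma_\ell(x_1^2,\dots,x_n^2)=\xi_\ell$ for $1\le\ell\le n-1$. The signs of the coefficients of $H$ alternate, the coefficient of $Z^{n-\ell}$ being $(-1)^\ell\xi_\ell$ (so the coefficient of $Z$ is $+\xi_{n-1}$ since $n$ is odd). $\Upsilon$ is a (local, non-constant) solution of the equation $\Upsilon'^2=\mathscr{D}_n(\Upsilon)$. *)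

(* Defs.v *)
From HB Require Import structures.
From mathcomp Require Export all_boot all_order all_algebra.
From mathcomp Require Export all_classical all_reals all_analysis.
From mathcomp.real_closed Require Export complex.
(* [mpoly] is not imported: its notations clash with those of MathComp-Analysis. *)
From mathcomp Require mpoly.

Export Order.TTheory GRing.Theory Num.Theory.
Export numFieldNormedType.Exports.

Set Implicit Arguments.
Unset Strict Implicit.
Unset Printing Implicit Defensive.

Local Open Scope classical_set_scope.
Local Open Scope ring_scope.

(* R[i] as a numClosedFieldType: the topology and the normed module structure over
   itself are attached to that structure, not to the bare carrier R[i]. *)
Definition Cplx (R : realType) : numClosedFieldType := R[i]%C.

Definition toC (R : realType) (x : R) : Cplx R := (x%:C)%C.

(* Points (x_1, ..., x_n) are functions on 'I_n, so x_k is the value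
   at the ordinal k - 1. *)

Definition elem_sym (K : comNzRingType) (n l : nat) (x : 'I_n -> K) : K :=
  mpoly.meval x (mpoly.mesym n K l).

Definition varpi1 (K : comNzRingType) (n : nat) (x : 'I_n -> K) : K :=
  (\prod_(j < n | (0 < j)%N) x j) *
  \prod_(i < n | (0 < i)%N) \prod_(j < n | (i < j)%N) (x i ^+ 2 - x j ^+ 2).

(* (x_k, x_{k+1}, ..., x_n, x_1, ..., x_{k-1}); [ordS] is the cyclic successor. *)
Definition cyclic_shift (K : Type) (n : nat) (k : 'I_n) (x : 'I_n -> K) :
  'I_n -> K := fun i => x (iter k (@ordS n) i).

(* xi l stands for xi_l; only the values with 1 <= l <= n - 1 are ever used. *)
Definition admissible (R : realType) (n : nat) (xi : nat -> R) : Prop :=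
  exists x : 'I_n -> R,
    forall l : nat, (1 <= l <= n.-1)%N -> elem_sym l (fun i => x i ^+ 2) = xi l.

Definition Hpoly (K : comNzRingType) (n : nat) (xi : nat -> K) : {poly K} :=
  'X^n + \sum_(1 <= l < n) ((-1) ^+ l * xi l) *: 'X^(n - l).

(* (-1)^(d(d-1)/2) Res(p, p') / a_d with d = deg p and a_d the leading
   coefficient, which is meant to be a unit (below it is 1).  [resultant] orders
   the rows and columns of the Sylvester matrix differently from the classical
   convention; the two determinants differ by (-1)^(deg p * deg p'), which is 1
   here since deg p' = d - 1 in characteristic 0. *)
Definition discrim (A : idomainType) (p : {poly A}) : A :=
  let d := (size p).-1 in
  (-1) ^+ 'C(d, 2) * (lead_coef p)^-1 * resultant p p^`().

(* The polynomial 4 x discrim_Z (H(Z) - x) in x: H(Z) - x is a polynomial in Z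
   with coefficients in K[x], the inner 'X being x. *)
Definition Dpoly (K : fieldType) (n : nat) (xi : nat -> K) : {poly K} :=
  4%:R *: ('X * discrim (map_poly polyC (Hpoly n xi) - ('X : {poly K})%:P)).

Definition hyperelliptic_solution (C : numFieldType) (n : nat) (xi : nat -> C)
    (U : set C) (Y : C -> C) : Prop :=
  [/\ forall t, U t -> derivable Y t 1,
      forall t, U t -> derive1 Y t ^+ 2 = (Dpoly n xi).[Y t]
    & exists s t, [/\ U s, U t & Y s <> Y t]].

(* P_1(t), ..., P_n(t) are the n solutions, with multiplicity, of H(X) = Y(t),
   labelled continuously in t. *)
Definition root_branches (C : numFieldType) (n : nat) (xi : nat -> C)
    (U : set C) (Y : C -> C) (P : 'I_n -> C -> C) : Prop :=
  (forall j t, U t -> {for t, continuous (P j)}) /\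
  (forall t, U t ->
    Hpoly n xi - (Y t)%:P = \prod_(j < n) ('X - (P j t)%:P)).

Definition solves_system (C : numFieldType) (n : nat) (xi : nat -> C)
    (U : set C) (p : 'I_n -> C -> C) : Prop :=
  (forall k t, U t ->
    is_derive t 1 (p k) (varpi1 (cyclic_shift k (fun j => p j t)))) /\
  (forall l t, (1 <= l <= n.-1)%N -> U t ->
    elem_sym l (fun j => p j t ^+ 2) = xi l).

(* Main.v *)
Require Import Defs.
From mathcomp Require Import ring lra.

(** Write V for the Vandermonde product of the roots P_1, ..., P_n of
    H(Z) - Y, that is, the product of P_i - P_j over i < j.  Since n is odd the
    product of the P_j is Y, and D_n(Y) = 4 Y V^2 (Dpoly_fiber), so that
    Y'^2 = 4 (prod_j P_j) V^2.  Differentiating H(P_k) = Y gives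
    P_k' prod_(j != k) (P_k - P_j) = Y' (branch_cdiff).  If p_j^2 = P_j and the
    signs are such that Y' = 2 (prod_j p_j) V, division by
    2 p_k prod_(j != k) (P_k - P_j) yields the equation for p_k', because V does
    not change when its n arguments are shifted cyclically: a cycle of odd
    length is an even permutation (vand_sq_varpi1).  Reversing the signs of all
    p_j at once reverses the sign of their product, again because n is odd; so
    the right choice of signs exists as soon as continuous square roots do.
    The symmetric functions of the p_j^2 = P_j are read off the coefficients of
    H (elem_sym_fiber).

    The work lies at the points where Y' = 0, where a root may be multiple or
    zero, and where a square root of P_j could branch.  Three facts settle
    them, and the mean value inequality along segments (mvt_seg) is the only
    analytic tool that they need.

    First, the zeros of Y' are isolated, and Y never reaches a multiple root
    of D_n (solution_isolated, solution_simple_root).  At a multiple root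
    |Y'| <= K |Y - y| forces Y to be locally constant.  At a simple root,
    Y'' = D_n'(Y) / 2 holds wherever Y' is nonzero and has a nonzero limit at
    the zeros of Y'; hence Y' moves away from its zeros almost linearly, so that
    no segment can have a gap between two zeros and no zero can be accompanied
    by others unless Y' vanishes identically nearby (zeros_dichotomy).  The
    connectedness of the disc excludes flat pieces, since Y is not constant.

    Second, the P_k have continuous square roots on the whole disc.  Near a
    point where P_k = 0 the other roots are nonzero and all are distinct, so
    Y' / (2 V h), with h a square root of the product of the other P_j, is a
    square root of P_k (branch_local_sqrt).  Two continuous square roots on a
    convex open set differ by a sign, because removing isolated points
    leaves such a set connected (loc_const_off_isolated, sqrt_unique), and local square roots
    therefore glue to one on the disc (sqrt_on_ball).

    Third, a continuous function whose derivative off one point has a limit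
    there is differentiable at that point (cdiff_limit); this carries the
    differential equations from the points with Y' nonzero to all points. *)

Set Implicit Arguments.
Unset Strict Implicit.
Unset Printing Implicit Defensive.

Local Open Scope classical_set_scope.
Local Open Scope ring_scope.

(** * The resultant in terms of roots *)

Definition vand (K : comNzRingType) (n : nat) (x : 'I_n -> K) : K :=
  \prod_(i < n) \prod_(j < n | (i < j)%N) (x i - x j).

Definition prod_XsubC (K : comNzRingType) (n : nat) (x : 'I_n -> K) : {poly K} :=
  \prod_(i < n) ('X - (x i)%:P).

Lemma vand_neq0 (K : idomainType) (n : nat) (x : 'I_n -> K) :
  injective x -> vand x != 0.
Proof.
move=> x_inj; apply/prodf_neq0 => i _; apply/prodf_neq0 => j ij.
by rewrite subr_eq0; apply: contraTneq ij => /x_inj ->; rewrite ltnn.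
Qed.

Lemma vand_neq0_inj (K : idomainType) (n : nat) (x : 'I_n -> K) :
  vand x != 0 -> injective x.
Proof.
move=> v0 i j xij; apply/eqP; apply: contraNT v0 => ij.
wlog lt : i j xij ij / (i < j)%N.
  move=> W; have [lt|lt|/val_inj e] := ltngtP i j; first exact: (W i j).
    by apply: (W j i); rewrite // eq_sym.
  by move: ij; rewrite e eqxx.
by rewrite /vand (bigD1 i) //= (bigD1 j) //= xij subrr !mul0r.
Qed.

Section Roots.
Variables (F : fieldType) (n : nat) (a : 'I_n -> F).
Let p := prod_XsubC a.

Lemma size_prod_XsubC_ord : size p = n.+1.
Proof.
rewrite /p /prod_XsubC -(big_map a xpredT (fun z => 'X - z%:P)).
by rewrite size_prod_XsubC size_map /index_enum -enumT size_enum_ord.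
Qed.

Lemma monic_prod_XsubC_ord : p \is monic.
Proof. exact: monic_prod_XsubC. Qed.

Lemma horner_prod_XsubC x : p.[x] = \prod_(i < n) (x - a i).
Proof.
by rewrite horner_prod; apply: eq_bigr => i _; rewrite hornerXsubC.
Qed.

Lemma horner_deriv_prod_XsubC i : p^`().[a i] = \prod_(j < n | j != i) (a i - a j).
Proof.
rewrite /p /prod_XsubC (bigD1 i) //= derivM derivXsubC mul1r hornerD hornerM.
rewrite hornerXsubC subrr mul0r addr0 horner_prod.
by apply: eq_bigr => j _; rewrite hornerXsubC.
Qed.

End Roots.

Lemma Sylvester_mx_mulXn (F : fieldType) (p q : {poly F}) :
  (forall i j, Sylvester_mx p q (lshift _ i) j = ('X^i * p)`_j) /\
  (forall i j, Sylvester_mx p q (rshift _ i) j = ('X^i * q)`_j).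
Proof.
split=> i j; rewrite Sylvester_mxE.
  case: splitP => [i' /= /val_inj <-|k /= e]; last first.
    by have := ltn_ord i; rewrite e ltnNge leq_addr.
  by rewrite coefXnM ltnNge; case: leqP; rewrite ?mulr1n ?mulr0n.
case: splitP => [k /= e|i' /= /addnI /val_inj <-].
  by have := ltn_ord k; rewrite -e ltnNge leq_addr.
by rewrite coefXnM ltnNge; case: leqP; rewrite ?mulr1n ?mulr0n.
Qed.

(** Multiply the Sylvester matrix on the right by the matrix whose first columns
    select the low coefficients and whose last columns evaluate a polynomial
    at the roots a_j of p.  The multiples of p evaluate to 0, so the product is
    block triangular: one block is triangular with constant diagonal p(0), the
    other is the Vandermonde matrix of the a_j scaled by the q(a_j).  The
    determinant of the multiplier is the Vandermonde determinant times a power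
    of the product of the a_j, which is why the roots are taken distinct and
    nonzero: these factors must cancel. *)
Lemma resultant_roots_aux (F : fieldType) (p q : {poly F})
    (a : 'I_(size p).-1 -> F) :
  p = prod_XsubC a -> injective a -> (forall i, a i != 0) ->
  resultant p q = (-1) ^+ ((size p).-1 * (size q).-1) * \prod_i q.[a i].
Proof.
move=> pE a_inj a_neq0.
set d := (size p).-1 in a a_inj a_neq0 pE *; set m := (size q).-1.
have szp : size p = d.+1 by rewrite {1}pE size_prod_XsubC_ord.
have [S [resE Sp Sq]] : exists S : 'M[F]_(m + d), [/\ resultant p q = \det S,
    forall i j, S (lshift d i) j = ('X^i * p)`_j
  & forall i j, S (rshift m i) j = ('X^i * q)`_j].
  by exists (Sylvester_mx p q); have [Sp Sq] := Sylvester_mx_mulXn p q.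
rewrite {}resE.
pose E1 : 'M[F]_(m, d) := \matrix_(i, j) a j ^+ i.
pose E2 : 'M[F]_(d, d) := \matrix_(i, j) a j ^+ (m + i).
(* the low coefficients, then the values at the roots *)
pose M := block_mx 1%:M E1 0 E2.
pose V : 'M[F]_d := Vandermonde d (\row_j a j).
have detV : \det V != 0.
  rewrite det_Vandermonde; apply/prodf_neq0 => i _; apply/prodf_neq0 => j ij.
  rewrite !mxE subr_eq0; apply: contraTneq ij => /a_inj ->.
  by rewrite ltnn.
have E2E : E2 = V *m diag_mx (\row_j a j ^+ m).
  by apply/matrixP => i j; rewrite mul_mx_diag !mxE -exprD addnC.
have detM : \det M = \det V * \prod_i a i ^+ m.
  rewrite det_ublock det1 mul1r E2E det_mulmx det_diag; congr (_ * _).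
  by apply: eq_bigr => i _; rewrite mxE.
have ev (r : {poly F}) k : (size r <= m + d)%N ->
    \sum_(j < m + d) r`_j * (col_mx E1 E2) j k = r.[a k].
  move=> szr; rewrite (horner_coef_wide _ szr); apply: eq_bigr => j _.
  rewrite mxE; case: splitP => l e; rewrite mxE e //.
have sz (r : {poly F}) c e : (c < e)%N -> (size ('X^c * r)%R <= e + (size r).-1)%N.
  move=> ce; have [->|r0] := eqVneq r 0; first by rewrite mulr0 size_poly0.
  rewrite size_monicM ?monicXn // size_polyXn addSn /=.
  have := r0; rewrite -size_poly_gt0; case: (size r) => // s _ /=.
  by rewrite addnS -addSn leq_add2r.
pose W := \matrix_(i < d, j < d) (a j ^+ i * q.[a j]).
have WE : W = V *m diag_mx (\row_j q.[a j]).
  by apply/matrixP => i j; rewrite mul_mx_diag !mxE.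
have SM : S *m M = block_mx (ulsubmx S) 0 (dlsubmx S) W.
  rewrite -[S in LHS]submxK /M mulmx_block !mulmx1 !mulmx0 !addr0.
  congr block_mx.
    rewrite -mul_row_col -/(ursubmx S) /ulsubmx /ursubmx hsubmxK.
    apply/matrixP => i k; rewrite !mxE.
    under eq_bigr => j _ do rewrite mxE Sp.
    rewrite ev; last by rewrite addnC /d; have := sz p i m (ltn_ord i); rewrite addnC.
    rewrite hornerM pE horner_prod_XsubC [X in _ * X](bigD1 k) //= subrr.
    by rewrite mul0r mulr0.
  rewrite -mul_row_col /dlsubmx /drsubmx hsubmxK.
  apply/matrixP => i k; rewrite !mxE.
  under eq_bigr => j _ do rewrite mxE Sq.
  rewrite ev; last by rewrite addnC /m; have := sz q i d (ltn_ord i).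
  by rewrite hornerM hornerXn.
have detT : \det (ulsubmx S) = (-1) ^+ (d * m) * \prod_i a i ^+ m.
  rewrite -det_tr det_trig; last first.
    apply/is_trig_mxP => i j ij; rewrite !mxE Sp coefXnM.
    by rewrite /= ij.
  rewrite (eq_bigr (fun=> p`_0)); last first.
    by move=> i _; rewrite !mxE Sp coefXnM /= ltnn subnn.
  rewrite prodr_const card_ord -horner_coef0 pE horner_prod_XsubC.
  have -> : \prod_(i < d) (0 - a i) = (-1) ^+ d * \prod_i a i.
    by under [LHS]eq_bigr => i _ do rewrite sub0r; rewrite prodrN card_ord.
  by rewrite exprMn -exprM prodrXl.
have := congr1 determinant SM; rewrite det_mulmx detM det_lblock detT WE.
rewrite det_mulmx det_diag.
have P0 : \prod_i a i ^+ m != 0.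
  by apply/prodf_neq0 => i _; rewrite expf_neq0.
have -> : \prod_i (\row_j q.[a j]) 0 i = \prod_i q.[a i].
  by apply: eq_bigr => i _; rewrite mxE.
move=> e; apply: (mulIf (mulf_neq0 detV P0)); rewrite e.
by rewrite -!mulrA; congr (_ * _); rewrite mulrC -mulrA mulrCA.
Qed.

Lemma resultant_roots (F : fieldType) (n : nat) (a : 'I_n -> F) (q : {poly F}) :
  injective a -> (forall i, a i != 0) ->
  resultant (prod_XsubC a) q
    = (-1) ^+ (n * (size q).-1) * \prod_(i < n) q.[a i].
Proof.
have := @resultant_roots_aux F (prod_XsubC a) q.
by rewrite size_prod_XsubC_ord; apply.
Qed.

(** A repeated root is a common root of p and p', which kills the resultant. *)
Lemma resultant_neq0_inj (F : fieldType) (n : nat) (a : 'I_n -> F) :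
  resultant (prod_XsubC a) (prod_XsubC a)^`() != 0 -> injective a.
Proof.
move=> res0 i j aij; apply/eqP; apply: contraNT res0 => ij.
set p := prod_XsubC a; rewrite resultant_eq0.
apply: (@root_size_gt1 _ (a i)).
  rewrite gcdp_eq0 negb_and; apply/orP; left.
  by rewrite monic_neq0 // monic_prod_XsubC_ord.
rewrite root_gcd /root horner_prod_XsubC horner_deriv_prod_XsubC.
rewrite (bigD1 i) //= subrr mul0r eqxx /=.
by rewrite (bigD1 j) 1?eq_sym //= aij subrr mul0r.
Qed.

(** Each pair i < j contributes (a_i - a_j) (a_j - a_i); the sign is collected
    from the n choose 2 pairs. *)
Lemma prod_root_differences (K : comNzRingType) (n : nat) (a : 'I_n -> K) :
  \prod_(i < n) \prod_(j < n | j != i) (a i - a j)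
    = (-1) ^+ 'C(n, 2) * vand a ^+ 2.
Proof.
have split_ne i : \prod_(j < n | j != i) (a i - a j)
    = \prod_(j < n | (i < j)%N) (a i - a j) * \prod_(j < n | (j < i)%N) (a i - a j).
  rewrite (bigID (fun j : 'I_n => (i < j)%N)) /=.
  congr (_ * _); apply: eq_bigl => j; rewrite -(inj_eq val_inj) /=; by case: ltngtP.
under eq_bigr => i _ do rewrite split_ne.
rewrite big_split /= -/(vand a).
have -> : \prod_(i < n) \prod_(j < n | (j < i)%N) (a i - a j)
    = (-1) ^+ 'C(n, 2) * vand a.
  rewrite (exchange_big_dep xpredT) //= /vand.
  have -> : (-1) ^+ 'C(n, 2) = \prod_(i < n) \prod_(j < n | (i < j)%N) (-1) :> K.
    rewrite (exchange_big_dep xpredT) //= -bin2_sum big_mkord expr_sum.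
    apply: eq_bigr => j _.
    by rewrite (big_ord_narrow (ltnW (ltn_ord j))) prodr_const card_ord.
  rewrite -big_split; apply: eq_bigr => i _ /=.
  by rewrite -big_split; apply: eq_bigr => j _ /=; rewrite mulN1r opprB.
by rewrite mulrCA.
Qed.

(** * The discriminant of H(Z) - x and its roots *)

Lemma size_deriv_char0 (C : numFieldType) (p : {poly C}) : size p^`() = (size p).-1.
Proof.
have [->|p0] := eqVneq p 0; first by rewrite linear0 size_poly0.
have sp : (0 < size p)%N by rewrite size_poly_gt0.
case sE : (size p) sp => [//|[|s]] _ /=.
  apply/eqP; rewrite size_poly_eq0.
  by have /size1_polyC -> : (size p <= 1)%N; [rewrite sE|rewrite derivC].
apply/eqP; rewrite eqn_leq -ltnS -{1}sE lt_size_deriv //=.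
rewrite ltnNge; apply/negP => /leq_sizeP /(_ s (leqnn _)) /eqP.
rewrite coef_deriv mulrn_eq0 /= => /eqP ps.
by move: p0; rewrite -lead_coef_eq0 /lead_coef sE /= ps eqxx.
Qed.

Lemma odd_neg_one_even (K : comNzRingType) m : ~~ odd m -> (-1) ^+ m = 1 :> K.
Proof. by move=> ev; rewrite -signr_odd (negbTE ev). Qed.

Section Discriminant.
Variables (C : numFieldType) (n : nat) (xi : nat -> C).
Hypothesis n_gt0 : (0 < n)%N.

Let G : {poly {poly C}} := map_poly polyC (Hpoly n xi) - ('X : {poly C})%:P.

Let eval_G y : map_poly (horner_eval y) G = Hpoly n xi - y%:P.
Proof.
have -> : map_poly (horner_eval y) G
    = map_poly (horner_eval y) (map_poly polyC (Hpoly n xi)) - (horner_eval y 'X)%:P.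
  by rewrite rmorphB; congr (_ - _); exact: map_polyC.
congr (_ - _%:P); last by rewrite /horner_eval hornerX.
by apply/polyP => i; rewrite !coef_map [LHS]hornerC.
Qed.

Lemma Hpoly_monic_size : size (Hpoly n xi) = n.+1 /\ Hpoly n xi \is monic.
Proof.
have sz : (size (\sum_(1 <= l < n) ((-1) ^+ l * xi l) *: 'X^(n - l) : {poly C})%R < size ('X^n : {poly C})%R)%N.
  rewrite size_polyXn ltnS; apply: (leq_trans (size_sum _ _ _)).
  rewrite big_seq; elim/big_ind: _ => //.
    by move=> x y xn yn; rewrite geq_max xn yn.
  move=> l; rewrite mem_index_iota => /andP[l1 ln].
  apply: (leq_trans (size_scale_leq _ _)); rewrite size_polyXn.
  by rewrite ltn_subrL l1 n_gt0.
by rewrite /Hpoly size_polyDl // size_polyXn; split=> //; rewrite monicE lead_coefDl // lead_coefXn.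
Qed.

(** Evaluation at y commutes with the resultant because it preserves the degrees
    of H(Z) - x and of its Z-derivative: their leading coefficients are the
    constants 1 and n. *)
Lemma discrim_horner y :
  (discrim G).[y] = (-1) ^+ 'C(n, 2) *
     resultant (Hpoly n xi - y%:P) (Hpoly n xi - y%:P)^`().
Proof.
have [szH monH] := Hpoly_monic_size.
have szG : size G = n.+1 /\ G \is monic.
  have sz : (size (- ('X : {poly C})%:P) < size (map_poly polyC (Hpoly n xi)))%N.
    rewrite size_polyN size_map_polyC szH ltnS.
    by rewrite size_polyC; case: eqP.
  rewrite /G size_polyDl // size_map_polyC szH; split=> //.
  by rewrite monicE lead_coefDl // lead_coef_map_inj ?(monicP monH) //; exact: polyC_inj.
have [sG mG] := szG.
rewrite /discrim sG /= (monicP mG) invr1 mulr1 hornerM.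
rewrite -[X in X * _]/(horner_eval y _) rmorphXn rmorphN1; congr (_ * _).
have sG' : lead_coef G^`() = n%:R.
  have dG : (size G^`() <= n)%N.
    by rewrite -ltnS -sG lt_size_deriv // monic_neq0.
  have cn : (G^`())`_n.-1 = n%:R.
    rewrite coef_deriv prednK //; have := monicP mG; rewrite /lead_coef sG /=.
    by move=> ->.
  have -> : n%:R = (G^`())`_n.-1 by [].
  congr (_`_ _.-1); apply/eqP; rewrite eqn_leq dG /= leqNgt; apply/negP => lt.
  have : (G^`())`_n.-1 = 0 by apply: nth_default; rewrite -ltnS prednK.
  by rewrite cn => /eqP; rewrite -polyC_natr polyC_eq0 pnatr_eq0 -leqn0 leqNgt n_gt0.
have h1 : horner_eval y (lead_coef G) != 0.
  by rewrite (monicP mG) rmorph1 oner_neq0.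
have h2 : horner_eval y (lead_coef G^`()) != 0.
  by rewrite sG' rmorph_nat pnatr_eq0 -lt0n.
by have := map_resultant h1 h2; rewrite -deriv_map eval_G => <-.
Qed.

Lemma Dpoly_horner y :
  (Dpoly n xi).[y] = 4%:R * y * ((-1) ^+ 'C(n, 2) *
     resultant (Hpoly n xi - y%:P) (Hpoly n xi - y%:P)^`()).
Proof. by rewrite /Dpoly hornerZ hornerM hornerX -discrim_horner mulrA. Qed.

Section Fiber.
Variables (y : C) (a : 'I_n -> C).
Hypothesis aE : Hpoly n xi - y%:P = prod_XsubC a.

Lemma elem_sym_fiber l : (1 <= l <= n.-1)%N -> elem_sym l a = xi l.
Proof.
move=> /andP[l1 ln].
have ln' : (l < n)%N by rewrite -(prednK n_gt0) ltnS.
have := congr1 (fun r : {poly C} => r`_(n - l)) aE.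
have -> : prod_XsubC a = \prod_(c <- [tuple a i | i < n]) ('X - c%:P).
  by rewrite big_tuple; apply: eq_bigr => i _; rewrite tnth_mktuple.
have lS : (l < n.+1)%N by rewrite ltnS ltnW.
have := mpoly.mroots_coeff [tuple a i | i < n] (Ordinal lS) => /= ->.
rewrite /Hpoly coefB coefD coefXn coefC subn_eq0 leqNgt ln' /= subr0.
rewrite (_ : (n - l == n)%N = false) ?add0r; last first.
  by rewrite -[X in _ == X]subn0 eqn_sub2lE ?(ltnW ln') //; case: l l1 {ln ln' lS}.
rewrite coef_sum (bigD1_seq l) /= ?mem_index_iota ?iota_uniq ?l1 ?ln' //.
rewrite coefZ coefXn eqxx mulr1 big_seq_cond big1 ?addr0; last first.
  move=> i /andP[]; rewrite mem_index_iota => /andP[i1 ilt] nil.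
  rewrite coefZ coefXn eqn_sub2lE 1?eq_sym ?(negbTE nil) ?mulr0 //; exact: ltnW.
move=> e; rewrite /elem_sym; have sgn : (-1) ^+ l != 0 :> C by rewrite signr_eq0.
apply: (mulfI sgn); rewrite e.
by congr (_ * _); apply: mpoly.meval_eq => i; rewrite tnth_mktuple.
Qed.

Lemma prod_fiber : odd n -> \prod_(i < n) a i = y.
Proof.
move=> n_odd; have := congr1 (fun r : {poly C} => r.[0]) aE.
rewrite horner_prod_XsubC /Hpoly hornerD hornerN hornerC hornerD hornerXn expr0n gtn_eqF // add0r.
rewrite horner_sum big_seq big1 ?sub0r; last first.
  move=> l; rewrite mem_index_iota => /andP[l1 ln].
  by rewrite hornerZ hornerXn expr0n subn_eq0 leqNgt ln mulr0.
under [X in _ = X -> _]eq_bigr => i _ do rewrite sub0r.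
by rewrite prodrN card_ord -signr_odd n_odd expr1 mulN1r => /oppr_inj.
Qed.

(** If a root is repeated both sides vanish.  The sign (-1)^(n (n - 1)) between the
    resultant and the product over the roots is trivial. *)
Lemma resultant_fiber : (forall i, a i != 0) ->
  (-1) ^+ 'C(n, 2) * resultant (Hpoly n xi - y%:P) (Hpoly n xi - y%:P)^`()
   = vand a ^+ 2.
Proof.
move=> a0; rewrite aE.
have [a_inj|not_inj] := pselect (injective a); last first.
  have -> : vand a = 0 by apply/eqP; apply: contra_notT not_inj; exact: vand_neq0_inj.
  have [->|r0] := eqVneq (resultant (prod_XsubC a) (prod_XsubC a)^`()) 0.
    by rewrite mulr0 expr0n.
  by case: not_inj; exact: resultant_neq0_inj.
rewrite resultant_roots // size_deriv_char0 size_prod_XsubC_ord /=.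
rewrite (@odd_neg_one_even _ (n * n.-1)) ?mul1r; last first.
  by case: (n) => // k; rewrite oddM /=; case: (odd k).
under eq_bigr => i _ do rewrite horner_deriv_prod_XsubC.
by rewrite prod_root_differences mulrA -expr2 sqrr_sign mul1r.
Qed.

(** The factor y of D_n is the product of the roots, so a zero root makes both
    sides vanish and resultant_fiber applies in the other case. *)
Lemma Dpoly_fiber : odd n -> (Dpoly n xi).[y] = 4%:R * y * vand a ^+ 2.
Proof.
move=> n_odd; rewrite Dpoly_horner.
have [->|y0] := eqVneq y 0; first by rewrite mulr0 !mul0r.
congr (_ * _); apply: resultant_fiber => i.
apply: contraNneq y0 => ai; rewrite -(prod_fiber n_odd).
by rewrite (bigD1 i) //= ai mul0r.
Qed.

(** At 0 the derivative of 4 x disc(x) is 4 disc(0); the discriminant separates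
    the roots of the fibre over 0 when it is not zero. *)
Lemma Dpoly_deriv0_fiber : y = 0 -> ((Dpoly n xi)^`()).[0] != 0 -> injective a.
Proof.
move=> y0; rewrite /Dpoly derivZ hornerZ derivM derivX mul1r hornerD.
rewrite [X in _ + X]hornerM hornerX mul0r addr0 discrim_horner => H.
apply: resultant_neq0_inj; rewrite -aE y0; apply: contraNneq H => ->.
by rewrite !mulr0.
Qed.

End Fiber.

End Discriminant.

(** * Cyclic shifts of the Vandermonde product *)

(** Moving the first argument to the end reverses the sign of n - 1 factors, an
    even number. *)
Lemma vand_ordS (K : comNzRingType) (n : nat) (x : 'I_n -> K) :
  odd n -> vand (fun i => x (ordS i)) = vand x.
Proof.
case: n x => // m x /= m_even; rewrite /vand.
have -> : \prod_(i < m.+1) \prod_(j < m.+1 | (i < j)%N) (x i - x j)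
  = (\prod_(i < m) (x ord0 - x (lift ord0 i))) *
    \prod_(i < m) \prod_(j < m | (i < j)%N) (x (lift ord0 i) - x (lift ord0 j)).
  rewrite big_ord_recl; congr (_ * _).
    by rewrite big_mkcond big_ord_recl /= mul1r.
  apply: eq_bigr => i _; rewrite big_mkcond big_ord_recl /= mul1r.
  by rewrite [RHS]big_mkcond; apply: eq_bigr => j _; rewrite /bump.
have ordSmax : ordS (ord_max : 'I_m.+1) = ord0.
  by apply/val_inj; rewrite /= modnn.
have ordSw (i : 'I_m) : ordS (widen_ord (leqnSn m) i) = lift ord0 i.
  by apply/val_inj; rewrite /= modn_small // ltnS.
rewrite big_ord_recr /= [X in _ * X]big1 ?mulr1; last first.
  by move=> j; rewrite ltnNge -ltnS ltn_ord.
have -> : \prod_(i < m) (x ord0 - x (lift ord0 i))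
    = \prod_(i < m) (x (lift ord0 i) - x ord0).
  have := @prodrN K _ 'I_m (fun i => x ord0 - x (lift ord0 i)).
  rewrite card_ord odd_neg_one_even ?mul1r // => <-.
  by apply: eq_bigr => i _; rewrite opprB.
rewrite mulrC -big_split /=; apply: eq_bigr => i _.
rewrite big_mkcond big_ord_recr /= ltn_ord ordSw ordSmax; congr (_ * _).
by rewrite [RHS]big_mkcond; apply: eq_bigr => j _; rewrite ordSw.
Qed.

Lemma vand_cyclic_shift (K : comNzRingType) (n : nat) (x : 'I_n -> K) k :
  odd n -> vand (cyclic_shift k x) = vand x.
Proof.
move=> n_odd; rewrite /cyclic_shift.
suff H m : vand (fun i => x (iter m (@ordS n) i)) = vand x by exact: H.
elim: m => [//|m IH]; rewrite -{}IH.
rewrite -[RHS]vand_ordS //.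
by congr vand; apply: funext => i; rewrite iterSr.
Qed.

(** The algebraic form of the differential equations: after the cyclic shift
    that brings p_k to the front, the Vandermonde product of the squares splits
    into the factors that contain p_k and those that make up varpi_1. *)
Lemma vand_sq_varpi1 (K : comNzRingType) (n : nat) (p : 'I_n -> K) (k : 'I_n) :
  odd n ->
  (\prod_(j < n) p j) * vand (fun j => p j ^+ 2)
  = p k * (\prod_(j < n | j != k) (p k ^+ 2 - p j ^+ 2))
    * varpi1 (cyclic_shift k p).
Proof.
case: n p k => // m p k n_odd.
set q := cyclic_shift k p.
have shift0 : iter k (@ordS m.+1) ord0 = k.
  apply/val_inj; have H l : (l < m.+1)%N -> val (iter l (@ordS m.+1) ord0) = l.
    elim: l => // l IH lt; rewrite iterS /= IH ?(ltnW lt) // modn_small //.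
  by rewrite H.
have q0 : q ord0 = p k by rewrite /q /cyclic_shift shift0.
have shift_bij : bijective (iter k (@ordS m.+1)).
  by elim: (val k) => [|l IH]; [exact: (Bijective (g:=id)) | exact: bij_comp (@ordS_bij _) IH].
have shift_inj := bij_inj shift_bij.
have ord_gt0 (j : 'I_m.+1) : (0 < j)%N = (j != ord0).
  by rewrite -(inj_eq val_inj) lt0n.
have -> : \prod_(j < m.+1) p j = \prod_(j < m.+1) q j.
  by rewrite (reindex (iter k (@ordS m.+1))) //; exact: onW_bij.
have -> : \prod_(j < m.+1 | j != k) (p k ^+ 2 - p j ^+ 2)
    = \prod_(j < m.+1 | (0 < j)%N) (q ord0 ^+ 2 - q j ^+ 2).
  rewrite (reindex (iter k (@ordS m.+1))) /=; last exact: onW_bij.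
  rewrite q0; apply: eq_bigl => j.
  by rewrite ord_gt0 -{2}shift0 (inj_eq shift_inj).
rewrite -q0 -(vand_cyclic_shift _ k n_odd).
have -> : cyclic_shift k (fun j => p j ^+ 2) = fun j => q j ^+ 2 by [].
rewrite /vand /varpi1 [\prod_(i < _) q i](bigD1 ord0) //=.
rewrite [\prod_(i < _) \prod_(j < _ | _) _](bigD1 ord0) //= -!mulrA; congr (_ * _).
rewrite mulrCA; congr (_ * _); congr (_ * _).
  by apply: eq_bigl => j; rewrite ord_gt0.
by apply: eq_bigl => j; rewrite ord_gt0.
Qed.

(** * Moduli and derivatives over R[i] *)

(** Caratheodory's form of the derivative: the difference quotient extends
    continuously to t with value l.  It turns the rules of calculus into products
    of continuous functions, and serves over both R and R[i]. *)
Definition cdiff (K : numFieldType) (f : K -> K) (t l : K) : Prop :=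
  exists psi : K -> K, [/\ {for t, continuous psi}, psi t = l
    & forall s, f s - f t = psi s * (s - t)].

Lemma cdiff_cvg (K : numFieldType) (f : K -> K) (t l : K) :
  cdiff f t l <-> (f (h + t) - f t) / h @[h --> 0^'] --> l.
Proof.
split=> [[psi [cpsi psit fE]]|H].
  have Hc : (psi \o shift t) x @[x --> 0^'] --> l.
    by rewrite -psit; apply/continuous_withinNshiftx.
  apply: cvg_trans Hc; apply: near_eq_cvg.
  near=> h; have h0 : h != 0 by near: h; exact: nbhs_dnbhs_neq.
  by rewrite /= fE addrK mulfK.
exists (fun s => if s == t then l else (f s - f t) / (s - t)); split.
- apply/continuous_withinNshiftx; rewrite eqxx; apply: cvg_trans H.
  apply: near_eq_cvg; near=> h.
  have h0 : h != 0 by near: h; exact: nbhs_dnbhs_neq.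
  by rewrite /= -subr_eq0 addrK (negbTE h0).
- by rewrite eqxx.
- move=> s; case: eqP => [->|/eqP st]; first by rewrite !subrr mulr0.
  by rewrite divfK // subr_eq0.
Unshelve. all: by end_near. Qed.

Lemma is_derive_cdiff (K : numFieldType) (f : K -> K) (t l : K) :
  is_derive t 1 f l <-> cdiff f t l.
Proof.
have E : (fun h => h^-1 *: ((f \o shift t) (h *: 1) - f t))
   = (fun h => (f (h + t) - f t) / h).
  apply: funext => h /=; rewrite [h *: 1]mulr1; exact: mulrC.
rewrite cdiff_cvg; split=> [[d v]|H].
  by move: d v; rewrite /derivable /derive E => d <-.
split; rewrite /derivable /derive E; first by apply/cvg_ex; exists l.
by apply/cvg_lim.
Qed.

Lemma derivable_cdiff (K : numFieldType) (f : K -> K) (t : K) :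
  derivable f t 1 -> cdiff f t (derive1 f t).
Proof.
move=> d; apply/is_derive_cdiff; split=> //.
by rewrite derive1E.
Qed.

Lemma cdiff_continuous (K : numFieldType) (f : K -> K) (t l : K) :
  cdiff f t l -> {for t, continuous f}.
Proof.
move=> [psi [cpsi psit fE]].
have -> : f = (fun s => psi s * (s - t) + f t).
  by apply: funext => s; rewrite -fE subrK.
apply: continuousD; last exact: cst_continuous.
apply: continuousM => //.
by apply: continuousB => //; exact: cst_continuous.
Qed.

Section Cplx.
Variable R : realType.
Local Notation C := (Cplx R).

(** The norm of R[i] takes values in R[i] itself; its real part allows estimates
    in the ordered field R. *)
Definition cabs (z : C) : R := complex.Re `|z|.

Lemma toC_cabs z : toC (cabs z) = `|z|.
Proof. by rewrite /toC /cabs normc_def. Qed.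

Lemma toC_le (x y : R) : (toC x <= toC y) = (x <= y).
Proof. exact: lecR. Qed.

Lemma toC_lt (x y : R) : (toC x < toC y) = (x < y).
Proof. exact: ltcR. Qed.

Lemma toC_gt0 (e : C) : 0 < e -> exists2 d : R, 0 < d & e = toC d.
Proof.
case: e => a b; rewrite ltcE /= => /andP[/eqP -> a0].
by exists a.
Qed.

Lemma toCD (x y : R) : toC (x + y) = toC x + toC y. Proof. exact: rmorphD. Qed.
Lemma toCB (x y : R) : toC (x - y) = toC x - toC y. Proof. exact: rmorphB. Qed.
Lemma toCM (x y : R) : toC (x * y) = toC x * toC y. Proof. exact: rmorphM. Qed.
Lemma toC1 : toC 1 = 1 :> C. Proof. exact: rmorph1. Qed.
Lemma toC0 : toC 0 = 0 :> C. Proof. exact: rmorph0. Qed.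
Lemma toC_eq0 (x : R) : (toC x == 0) = (x == 0).
Proof. by rewrite -toC0 (inj_eq (@complexI R)). Qed.

Lemma cabs_toC (x : R) : cabs (toC x) = `|x|.
Proof. by rewrite /cabs normc_def /= expr0n addr0 sqrtr_sqr. Qed.

Lemma cabs_ge0 z : 0 <= cabs z.
Proof. by rewrite -toC_le toC_cabs toC0. Qed.

Lemma cabs_eq0 z : (cabs z == 0) = (z == 0).
Proof. by rewrite -toC_eq0 toC_cabs normr_eq0. Qed.

Lemma cabs_gt0 z : (0 < cabs z) = (z != 0).
Proof. by rewrite lt_def cabs_ge0 andbT cabs_eq0. Qed.

Lemma cabs0 : cabs 0 = 0. Proof. by apply/eqP; rewrite cabs_eq0. Qed.

Lemma cabsM z w : cabs (z * w) = cabs z * cabs w.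
Proof. by apply: (@complexI R); rewrite rmorphM -!/(toC _) !toC_cabs normrM. Qed.

Lemma cabsV z : cabs z^-1 = (cabs z)^-1.
Proof. by apply: (@complexI R); rewrite fmorphV -!/(toC _) !toC_cabs normfV. Qed.

Lemma cabsN z : cabs (- z) = cabs z.
Proof. by rewrite /cabs normrN. Qed.

Lemma cabsB z w : cabs (z - w) = cabs (w - z).
Proof. by rewrite -cabsN opprB. Qed.

Lemma cabsD z w : cabs (z + w) <= cabs z + cabs w.
Proof. by rewrite -toC_le toCD !toC_cabs ler_normD. Qed.

Lemma cabs_trans y x z : cabs (x - z) <= cabs (x - y) + cabs (y - z).
Proof. by have := cabsD (x - y) (y - z); rewrite addrA subrK. Qed.

Lemma Re_le_cabs z : `|complex.Re z| <= cabs z.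
Proof. by rewrite -toC_le toC_cabs; exact: normc_ge_Re. Qed.

Lemma cabs_i : cabs ('i%C : C) = 1.
Proof. by rewrite /cabs normc_def /= expr0n expr1n add0r sqrtr1. Qed.

Lemma Im_le_cabs z : `|complex.Im z| <= cabs z.
Proof.
rewrite -normrN -ReiNIm; apply: (le_trans (Re_le_cabs _)).
have -> : cabs (z * 'i%C) = cabs z * cabs 'i%C by exact: cabsM.
by rewrite cabs_i mulr1.
Qed.

Lemma nearC (P : C -> Prop) t :
  (\forall s \near t, P s) <-> exists2 e : R, 0 < e & forall s, cabs (s - t) < e -> P s.
Proof.
split.
  move=> /nbhs_ballP[e /toC_gt0 [d d0 ->] H]; exists d => // s st; apply: H.
  by rewrite -ball_normE /ball_ /= distrC -toC_cabs toC_lt.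
move=> [e e0 H]; apply/nbhs_ballP; exists (toC e); first by rewrite /= -toC0 toC_lt.
by move=> s; rewrite -ball_normE /ball_ /= distrC -toC_cabs toC_lt; exact: H.
Qed.

Lemma ballC t (r : R) s : ball t (toC r) s <-> cabs (s - t) < r.
Proof. by rewrite -ball_normE /ball_ /= distrC -toC_cabs toC_lt. Qed.

Lemma continuousC (f : C -> C) t : {for t, continuous f} <->
  forall e : R, 0 < e -> \forall s \near t, cabs (f s - f t) < e.
Proof.
rewrite /prop_for /continuous_at; split=> [|H].
  move=> /cvgrPdist_lt H e e0; have /H {}H : 0 < toC e by rewrite -toC0 toC_lt.
  near=> s; rewrite cabsB -toC_lt toC_cabs; near: s; exact: H.
apply/(@cvgrPdist_lt _ _ _ (nbhs t)) => _ /toC_gt0[e e0 ->]; near=> s.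
rewrite -toC_cabs toC_lt cabsB; near: s; exact: H.
Unshelve. all: by end_near. Qed.

Lemma continuous_toC : continuous (@toC R : R -> C).
Proof.
move=> x; apply/cvgrPdist_lt => _ /toC_gt0[e e0 ->]; near=> y.
rewrite -toCB -toC_cabs toC_lt cabs_toC; near: y.
exact: cvgr_dist_lt.
Unshelve. all: by end_near. Qed.

Lemma continuous_Re : continuous (fun z : C => complex.Re z : R).
Proof.
move=> z; apply/(@cvgrPdist_lt _ _ _ (nbhs z)) => e e0.
have /continuousC /(_ e e0) : {for z, continuous (@id C)} by [].
move=> H; near=> w; rewrite -raddfB; apply: (le_lt_trans (Re_le_cabs _)).
rewrite cabsB; near: w; exact: H.
Unshelve. all: by end_near. Qed.

Definition seg (a b : C) (u : R) : C := a + toC u * (b - a).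

Lemma seg0 a b : seg a b 0 = a. Proof. by rewrite /seg toC0 mul0r addr0. Qed.
Lemma seg1 a b : seg a b 1 = b. Proof. by rewrite /seg toC1 mul1r addrC subrK. Qed.
Lemma segB a b u v : seg a b u - seg a b v = toC (u - v) * (b - a).
Proof. rewrite /seg toCB; ring. Qed.

Lemma continuous_seg a b : continuous (seg a b).
Proof.
move=> u; suff : {for u, continuous (fun v => a + toC v * (b - a))} by [].
apply: continuousD; first exact: cst_continuous.
by apply: continuousM; [exact: continuous_toC|exact: cst_continuous].
Qed.

Lemma cdiff_seg (f : C -> C) (a b k : C) (u : R) (l : C) :
  cdiff f (seg a b u) l ->
  is_derive u 1 (fun v => complex.Re (k * f (seg a b v)) : R)
     (complex.Re (k * l * (b - a))).
Proof.
move=> [psi [cpsi psit fE]]; apply/is_derive_cdiff.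
exists (fun v => complex.Re (k * psi (seg a b v) * (b - a))); split.
- apply: (@continuous_comp _ _ _ (fun v => k * psi (seg a b v) * (b - a))
    (fun z : C => complex.Re z)); last exact: continuous_Re.
  apply: continuousM; last exact: cst_continuous.
  apply: continuousM; first exact: cst_continuous.
  by apply: (@continuous_comp _ _ _ (seg a b) psi); [exact: continuous_seg|].
- by rewrite psit.
- move=> v; rewrite -raddfB -mulrBr.
  have -> : k * (f (seg a b v) - f (seg a b u))
      = toC (v - u) * (k * psi (seg a b v) * (b - a)).
    by rewrite fE segB; ring.
  by case: (k * psi _ * (b - a)) => x y; rewrite /= mul0r subr0 mulrC.
Qed.

(** The mean value theorem fails for complex values, but rotating the increment
    of f - L z to the positive real axis reduces the inequality to the real
    theorem for the real part along the segment. *)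
Lemma mvt_seg (f phi : C -> C) a b L (eta : R) :
  (forall u, 0 <= u <= 1 -> {for seg a b u, continuous f}) ->
  (forall u, 0 < u < 1 -> cdiff f (seg a b u) (phi (seg a b u)) /\
     cabs (phi (seg a b u) - L) <= eta) ->
  cabs (f b - f a - L * (b - a)) <= eta * cabs (b - a).
Proof.
move=> fc fd; set v := f b - f a - _.
have eta0 : 0 <= eta.
  apply: le_trans (cabs_ge0 _) (proj2 (fd (2^-1) _)).
  by rewrite invr_gt0 ltr0n invf_lt1 ?ltr1n.
have [->|v0] := eqVneq v 0; first by rewrite cabs0 mulr_ge0 // cabs_ge0.
(* the rotation that makes v a nonnegative real number *)
pose k : C := toC (cabs v) / v.
have ck : cabs k = 1.
  by rewrite cabsM cabsV cabs_toC ger0_norm ?cabs_ge0 // mulfV // cabs_eq0.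
pose h (z : C) := f z - L * z.
have hd u : 0 < u < 1 -> cdiff h (seg a b u) (phi (seg a b u) - L).
  move=> /fd[[psi [cpsi psit fE]] _]; exists (fun s => psi s - L); split.
  - by apply: continuousB; [exact: cpsi|exact: cst_continuous].
  - by rewrite psit.
  - by move=> s; rewrite mulrBl -fE /h; ring.
pose F u : R := complex.Re (k * h (seg a b u)).
have [] := @MVT R F (fun u => complex.Re (k * (phi (seg a b u) - L) * (b - a))) 0 1 ltr01.
- by move=> u; rewrite in_itv /= => /hd /cdiff_seg; exact.
- apply/continuous_in_subspaceT => u; rewrite inE /= in_itv /= => u01.
  apply: (@continuous_comp _ _ _ (fun v => k * h (seg a b v))
    (fun z : C => complex.Re z)); last exact: continuous_Re.
  apply: continuousM; first exact: cst_continuous.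
  apply: (@continuous_comp _ _ _ (seg a b) h); first exact: continuous_seg.
  apply: continuousB; first exact: fc.
  by apply: continuousM; [exact: cst_continuous|].
move=> u; rewrite in_itv /= => u01; rewrite /F seg0 seg1 subr0 mulr1.
rewrite -raddfB -mulrBr.
have -> : h b - h a = v by rewrite /h /v; ring.
rewrite /k divfK // => e.
have -> : cabs v = complex.Re (toC (cabs v)) by [].
rewrite e; apply: (le_trans (ler_norm _)); apply: (le_trans (Re_le_cabs _)).
rewrite cabsM cabsM -/k ck mul1r ler_wpM2r ?cabs_ge0 //.
exact: (fd u u01).2.
Qed.

End Cplx.

(** * Connectedness: segments, convex sets, isolated points *)

(** Heine-Borel in the form of an induction: a hereditary property of open
    intervals that holds near each point and passes to overlapping unions holds
    on a neighbourhood of [A, B]. *)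
Lemma interval_induction (R : realType) (Q : R -> R -> Prop) (A B : R) :
  A <= B ->
  (forall a b a' b', a <= a' -> b' <= b -> Q a b -> Q a' b') ->
  (forall a c x b d, A <= x <= B -> a <= c -> c < x -> x < b -> b <= d ->
     Q a b -> Q c d -> Q a d) ->
  (forall x, A <= x <= B -> exists2 e, 0 < e & Q (x - e) (x + e)) ->
  exists2 e, 0 < e & Q (A - e) (B + e).
Proof.
move=> AB mono glue loc.
pose S := [set x | A <= x <= B /\ exists2 e, 0 < e & Q (A - e) (x + e)].
have SA : S A by split; [rewrite lexx AB|apply: loc; rewrite lexx AB].
have Sub : ubound S B by move=> x [/andP[]].
have Ssup : has_sup S by split; [exists A|exists B].
pose s := sup S.
have sA : A <= s by apply: ub_le_sup => //; exists B.
have sB : s <= B by apply: ge_sup => //; exists A.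
have [e e0 Qe] := loc s (introT andP (conj sA sB)).
have [x [/andP[xA xB] [e' e'0 Qx]] sx] := sup_adherent e0 Ssup.
have xs : x <= s by apply: ub_le_sup; [exists B|split; [rewrite xA xB|exists e']].
have Qs : Q (A - e') (s + e).
  apply: (glue _ (Num.max (A - e') (s - e)) x (Num.min (x + e') (s + e))).
  - by rewrite xA xB.
  - by rewrite le_max lexx.
  - by rewrite gt_max sx andbT; lra.
  - by rewrite lt_min; apply/andP; split; lra.
  - by rewrite ge_min lexx orbT.
  - by apply: mono Qx => //; rewrite ge_min lexx.
  - by apply: mono Qe => //; rewrite le_max lexx orbT.
have [sltB|Bs] := ltP s B; last first.
  have {Bs sB} -> : B = s by apply/eqP; rewrite eq_le Bs sB.
  exists (Num.min e' e); first by rewrite lt_min e'0 e0.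
  apply: mono Qs; first by rewrite lerB // ge_min lexx.
  by rewrite lerD // ge_min lexx orbT.
pose y := Num.min B (s + e / 2).
have yB : y <= B by rewrite ge_min lexx.
have ye : y <= s + e / 2 by rewrite ge_min lexx orbT.
have ys : s < y by rewrite lt_min sltB /=; lra.
have : S y.
  split; first by rewrite yB andbT; lra.
  exists (Num.min e' (e / 2)); first by rewrite lt_min e'0 /=; lra.
  apply: mono Qs; first by rewrite lerB // ge_min lexx.
  have : Num.min e' (e / 2) <= e / 2 by rewrite ge_min lexx orbT.
  lra.
move=> /(ub_le_sup (ex_intro _ B Sub)); rewrite -/s; lra.
Qed.

Lemma convex_comb_lt (R : realFieldType) (u x y r : R) :
  0 <= u <= 1 -> x < r -> y < r -> (1 - u) * x + u * y < r.
Proof.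
move=> /andP[]; rewrite le_eqVlt => /orP[/eqP <- _ xr _|u0 u1 xr yr].
  by rewrite subr0 mul1r mul0r addr0.
have h1 : (1 - u) * x <= (1 - u) * r by rewrite ler_wpM2l ?subr_ge0 // ltW.
have h2 : u * y < u * r by rewrite ltr_pM2l.
lra.
Qed.

Section Cplx.
Variable R : realType.
Local Notation C := (Cplx R).
Implicit Types (W : set C) (P : C -> Prop).

Definition openC W := forall t, W t -> \forall s \near t, W s.
Definition convexC W := forall a b (u : R), W a -> W b -> 0 <= u <= 1 -> W (seg a b u).

Lemma cabs_seg (a b c : C) (u r : R) : 0 <= u <= 1 ->
  cabs (a - c) < r -> cabs (b - c) < r -> cabs (seg a b u - c) < r.
Proof.
move=> u01 ac bc; have /andP[u0 u1] := u01.
have -> : seg a b u - c = toC (1 - u) * (a - c) + toC u * (b - c).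
  by rewrite /seg toCB toC1; ring.
apply: (le_lt_trans (cabsD _ _)); rewrite !cabsM !cabs_toC !ger0_norm ?subr_ge0 //.
exact: convex_comb_lt.
Qed.

Lemma convex_ball t (r : R) : convexC (ball t (toC r)).
Proof. by move=> a b u /ballC ta /ballC tb u01; apply/ballC; exact: cabs_seg. Qed.

Lemma open_ballC t (r : R) : openC (ball t (toC r)).
Proof.
move=> s /ballC st; apply/nearC; exists (r - cabs (s - t)); first by rewrite subr_gt0.
move=> w ws; apply/ballC; apply: (le_lt_trans (cabs_trans s _ _)); lra.
Qed.

Lemma loc_const_convex W P a b : openC W -> convexC W ->
  (forall t, W t -> \forall s \near t, P s <-> P t) -> W a -> W b -> P a -> P b.
Proof.
move=> oW cW loc Wa Wb.
pose Q x y := forall u v : R, x < u < y -> x < v < y -> W (seg a b u) ->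
  W (seg a b v) -> P (seg a b u) -> P (seg a b v).
have [] := @interval_induction R Q 0 1 ler01.
- move=> x y x' y' xx' yy' H u v /andP[u1 u2] /andP[v1 v2]; apply: H; apply/andP; split; lra.
- move=> x c z y d z01 xc cz zy yd H1 H2 u v /andP[u1 u2] /andP[v1 v2] Wu Wv Pu.
  have Wz : W (seg a b z) by exact: cW.
  have Pz : P (seg a b z).
    have [uy|yu] := ltP u y; last first.
      by apply: (H2 u z) => //; apply/andP; split; lra.
    by apply: (H1 u z) => //; apply/andP; split; lra.
  have [vy|yv] := ltP v y; last first.
    by apply: (H2 z v) => //; apply/andP; split; lra.
  by apply: (H1 z v) => //; apply/andP; split; lra.
- move=> x x01; have /loc := cW a b x Wa Wb x01.
  move=> /(continuous_seg (a:=a) (b:=b)) /nbhs_ballP[e /= e0 H].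
  exists e => // u v /andP[u1 u2] /andP[v1 v2] _ _.
  have Hu : P (seg a b u) <-> P (seg a b x).
    by apply: H; rewrite -ball_normE /ball_ /= ltr_distl; apply/andP; split; lra.
  have Hv : P (seg a b v) <-> P (seg a b x).
    by apply: H; rewrite -ball_normE /ball_ /= ltr_distl; apply/andP; split; lra.
  by move=> /Hu /Hv.
move=> e e0 H; rewrite -{1}(seg0 a b) -{2}(seg1 a b); apply: H.
- by apply/andP; split; lra.
- by apply/andP; split; lra.
- by rewrite seg0.
- by rewrite seg1.
Qed.

Definition half_disc (t : C) (d : R) (k : C) : set C :=
  [set s | cabs (s - t) < d /\ 0 < complex.Re (k * (s - t))].

Lemma Re_seg (k a b t : C) u : complex.Re (k * (seg a b u - t)) =
  (1 - u) * complex.Re (k * (a - t)) + u * complex.Re (k * (b - t)) :> R.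
Proof.
have -> : k * (seg a b u - t) = toC (1 - u) * (k * (a - t)) + toC u * (k * (b - t)).
  by rewrite /seg toCB toC1; ring.
by move: (k * (a - t)) (k * (b - t)) => [x1 y1] [x2 y2] /=; rewrite !mul0r !subr0.
Qed.

Lemma convex_half_disc t d k : convexC (half_disc t d k).
Proof.
move=> a b u [a1 a2] [b1 b2] u01; split; first exact: cabs_seg.
rewrite Re_seg -oppr_lt0 opprD -!mulrN; apply: convex_comb_lt => //; by rewrite oppr_lt0.
Qed.

Lemma open_half_disc t d k : openC (half_disc t d k).
Proof.
move=> s [s1 s2]; near=> w; split.
  apply/ballC; near: w; apply: open_ballC; exact/ballC.
near: w.
have c : {for s, continuous (fun w : C => complex.Re (k * (w - t)) : R)}.
  apply: (@continuous_comp _ _ _ (fun w : C => k * (w - t)) (fun z : C => complex.Re z));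
    last exact: continuous_Re.
  apply: continuousM; first exact: cst_continuous.
  by apply: continuousB; [exact: cvg_id|exact: cst_continuous].
exact: (cvgr_gt _ c).
Unshelve. all: by end_near. Qed.

(** A punctured disc is covered by four half-discs; each of them is convex and
    meets the next one, so a locally constant property is constant. *)
Lemma loc_const_punctured t (d : R) P : 0 < d ->
  (forall s, s != t -> cabs (s - t) < d -> \forall w \near s, P w <-> P s) ->
  forall a b, a != t -> b != t -> cabs (a - t) < d -> cabs (b - t) < d -> P a -> P b.
Proof.
move=> d0 loc.
have half k a b : half_disc t d k a -> half_disc t d k b -> P a -> P b.
  apply: loc_const_convex; [exact: open_half_disc|exact: convex_half_disc|].
  move=> s [s1 s2]; apply: loc => //.
  by apply: contraTneq s2 => ->; rewrite subrr mulr0 ltxx.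
(* points with coordinates 0, 1 or -1 in units of d / 4 link the half-discs *)
pose p (x y : R) : C := t + toC (d / 4) * (x +i* y)%C.
have pE (k : C) x y : x ^+ 2 + y ^+ 2 < 16 -> 0 < complex.Re (k * (x +i* y)%C) :> R ->
    half_disc t d k (p x y).
  move=> xy kxy; rewrite /half_disc /p /= [t + _]addrC addrK cabsM cabs_toC ger0_norm; last by lra.
  have -> : cabs (x +i* y)%C = Num.sqrt (x ^+ 2 + y ^+ 2) by rewrite /cabs normc_def.
  have : Num.sqrt (x ^+ 2 + y ^+ 2) < 4.
    rewrite (_ : 4 = Num.sqrt 16) ?ltr_sqrt //.
    by rewrite (_ : 16 = 4 ^+ 2) ?sqrtr_sqr ?ger0_norm //; lra.
  have -> : complex.Re (k * (toC (d / 4) * (x +i* y)%C))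
     = d / 4 * complex.Re (k * (x +i* y)%C).
    by rewrite mulrCA; case: (k * _) => u v /=; rewrite mul0r subr0.
  by move=> xy4; split; nra.
have ref s : s != t -> cabs (s - t) < d -> (P s -> P (p 1 0)) /\ (P (p 1 0) -> P s).
  rewrite -subr_eq0 => st sd.
  have sh k : 0 < complex.Re (k * (s - t)) :> R -> half_disc t d k s by [].
  have [xpos|xneg] := ltP 0 (complex.Re (s - t) : R).
    have s1 : half_disc t d 1 s by apply: sh; rewrite mul1r.
    have p1 : half_disc t d 1 (p 1 0) by apply: pE; rewrite /=; lra.
    by split; apply: (half 1).
  have [ypos|] := ltP 0 (complex.Im (s - t) : R).
    have s1 : half_disc t d (0 +i* -1)%C s.
      by apply: sh; move: ypos; case: (s - t) => x y /=; lra.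
    have p1 : half_disc t d (0 +i* -1)%C (p 1 1) by apply: pE; rewrite /=; lra.
    have p2 : half_disc t d 1 (p 1 1) by apply: pE; rewrite /=; lra.
    have p3 : half_disc t d 1 (p 1 0) by apply: pE; rewrite /=; lra.
    split=> H; first by apply: (half _ _ _ p2 p3); apply: (half _ _ _ s1 p1).
    by apply: (half _ _ _ p1 s1); apply: (half _ _ _ p3 p2).
  rewrite le_eqVlt => /orP[/eqP y0|yneg].
    have s1 : half_disc t d (-1) s.
      apply: sh; rewrite mulN1r raddfN oppr_gt0.
      move: st xneg y0; case: (s - t) => x y /= st x0 y0.
      by rewrite lt_neqAle x0 andbT; apply: contraNneq st => x0'; rewrite x0' y0.
    have p1 : half_disc t d (-1) (p (-1) 1) by apply: pE; rewrite /=; lra.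
    have p2 : half_disc t d (0 +i* -1)%C (p (-1) 1) by apply: pE; rewrite /=; lra.
    have p3 : half_disc t d (0 +i* -1)%C (p 1 1) by apply: pE; rewrite /=; lra.
    have p4 : half_disc t d 1 (p 1 1) by apply: pE; rewrite /=; lra.
    have p5 : half_disc t d 1 (p 1 0) by apply: pE; rewrite /=; lra.
    split=> H.
      apply: (half _ _ _ p4 p5); apply: (half _ _ _ p2 p3); exact: (half _ _ _ s1 p1).
    apply: (half _ _ _ p1 s1); apply: (half _ _ _ p3 p2); exact: (half _ _ _ p5 p4).
  have s1 : half_disc t d (0 +i* 1)%C s.
    by apply: sh; move: yneg; case: (s - t) => x y /=; lra.
  have p1 : half_disc t d (0 +i* 1)%C (p 1 (-1)) by apply: pE; rewrite /=; lra.
  have p2 : half_disc t d 1 (p 1 (-1)) by apply: pE; rewrite /=; lra.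
  have p3 : half_disc t d 1 (p 1 0) by apply: pE; rewrite /=; lra.
  split=> H; first by apply: (half _ _ _ p2 p3); apply: (half _ _ _ s1 p1).
  by apply: (half _ _ _ p1 s1); apply: (half _ _ _ p3 p2).
by move=> a b at_ bt ad bd /(ref a at_ ad).1 /(ref b bt bd).2.
Qed.

Definition isolated (Z : set C) W := forall t, W t ->
  exists2 e : R, 0 < e & forall s, cabs (s - t) < e -> s != t -> ~ Z s.

(** The germ Q of P on a punctured neighbourhood is defined on all of W, agrees
    with P off Z, and is locally constant because punctured discs are
    connected. *)
Lemma loc_const_off_isolated W (Z : set C) P a b : openC W -> convexC W ->
  isolated Z W -> (forall t, W t -> ~ Z t -> \forall s \near t, P s <-> P t) ->
  W a -> W b -> ~ Z a -> ~ Z b -> P a -> P b.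
Proof.
move=> oW cW iZ loc.
pose Q t := exists2 e : R, 0 < e & forall s, cabs (s - t) < e -> s != t -> P s.
have pick t (e : R) : 0 < e -> exists2 s, s != t & cabs (s - t) < e.
  move=> e0; exists (t + toC (e / 2)).
    rewrite -subr_eq0 [t + _]addrC addrK toC_eq0; apply: lt0r_neq0; lra.
  by rewrite [t + _]addrC addrK cabs_toC ger0_norm; lra.
have good t : W t -> exists2 e : R, 0 < e & forall s, cabs (s - t) < e -> W s /\ (s != t -> ~ Z s).
  move=> Wt; have /nearC[e1 e10 H1] := oW t Wt; have [e2 e20 H2] := iZ t Wt.
  exists (Num.min e1 e2); first by rewrite lt_min e10.
  by move=> s; rewrite lt_min => /andP[s1 s2]; split; [exact: H1|exact: H2].
have PQ t : W t -> ~ Z t -> P t <-> Q t.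
  move=> Wt Zt; have /nearC[e e0 H] := loc t Wt Zt; split.
    by move=> Pt; exists e => // s st _; apply/H.
  move=> [e' e'0 H'].
  have [|s st] := pick t (Num.min e e'); first by rewrite lt_min e0.
  by rewrite lt_min => /andP[s1 s2]; apply/(H s s1); exact: H'.
have locQ t : W t -> \forall s \near t, Q s <-> Q t.
  move=> Wt; have [e e0 He] := good t Wt.
  have Pconst s1 s2 : s1 != t -> s2 != t -> cabs (s1 - t) < e -> cabs (s2 - t) < e -> P s1 -> P s2.
    apply: loc_const_punctured => // s st se; have [Ws Zs] := He s se.
    by apply: loc => //; exact: Zs.
  apply/nearC; exists e => // s se; have [->//|st] := eqVneq s t.
  have [Ws /(_ st) Zs] := He s se; rewrite -PQ //.
  split=> [Ps|[e' e'0 H']].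
    by exists e => // w we wt; apply: (Pconst s w).
  have [|w wt] := pick t (Num.min e e'); first by rewrite lt_min e0.
  rewrite lt_min => /andP[w1 w2]; apply: (Pconst w s) => //; exact: H'.
move=> Wa Wb Za Zb /PQ Pa; apply/PQ => //.
by apply: (loc_const_convex oW cW locQ Wa Wb); exact: Pa.
Qed.

End Cplx.

(** * Continuous square roots *)

Section Sqrt.
Variable R : realType.
Local Notation C := (Cplx R).
Implicit Types (W : set C) (f g s : C -> C).

Lemma continuous_near_eq f g (t : C) : (\forall w \near t, f w = g w) ->
  {for t, continuous f} -> {for t, continuous g}.
Proof.
move=> fg /continuousC fc; apply/continuousC => e e0.
have fgt := nbhs_singleton fg.
near=> w; rewrite -fgt -(near fg w) //; near: w; exact: fc.
Unshelve. all: by end_near. Qed.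

Lemma continuous_neq0 f (t : C) : {for t, continuous f} -> f t != 0 ->
  \forall w \near t, f w != 0.
Proof.
move=> /continuousC fc; rewrite -cabs_gt0 => ft; have := fc _ ft.
apply: filterS => w fw; apply: contraTneq fw => ->.
by rewrite sub0r cabsN ltxx.
Qed.

Definition sqrt_on W f s := forall t, W t -> {for t, continuous s} /\ s t ^+ 2 = f t.

(** Where f is nonzero s1 - s2 and s1 + s2 cannot vanish together, so the
    condition s1 = s2 is locally constant off the isolated zeros of f, hence
    constant there. *)
Lemma sqrt_unique W f s1 s2 : openC W -> convexC W ->
  isolated [set t | f t = 0] W -> sqrt_on W f s1 -> sqrt_on W f s2 ->
  (forall t, W t -> s1 t = s2 t) \/ (forall t, W t -> s1 t = - s2 t).
Proof.
move=> oW cW iZ S1 S2.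
have sq t : W t -> (s1 t - s2 t) * (s1 t + s2 t) = 0.
  by move=> Wt; rewrite -subr_sqr (S1 t Wt).2 (S2 t Wt).2 subrr.
have s20 t : W t -> f t = 0 -> s1 t = 0 /\ s2 t = 0.
  move=> Wt ft0; split; apply/eqP; rewrite -sqrf_eq0.
    by rewrite (S1 t Wt).2 ft0.
  by rewrite (S2 t Wt).2 ft0.
have loc (t : C) : W t -> ~ f t = 0 -> \forall w \near t, (s1 w = s2 w) <-> (s1 t = s2 t).
  move=> Wt /eqP ft; have [c1 e1] := S1 t Wt; have [c2 e2] := S2 t Wt.
  have [eqt|neqt] := pselect (s1 t = s2 t); last first.
    have : \forall w \near t, s1 w - s2 w != 0.
      apply: (@continuous_neq0 (fun w => s1 w - s2 w)); first exact: (continuousB c1 c2).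
      by rewrite subr_eq0; apply/eqP.
    by apply: filterS => w; rewrite subr_eq0 => /eqP h; split.
  have : \forall w \near t, s1 w + s2 w != 0.
    apply: (@continuous_neq0 (fun w => s1 w + s2 w)); first exact: (continuousD c1 c2).
    rewrite eqt -mulr2n mulrn_eq0 /=; apply: contraNneq ft => s2t.
    by rewrite -e2 s2t expr0n.
  move=> H; near=> w; split=> // _.
  have Ww : W w by near: w; exact: oW.
  have sw : s1 w + s2 w != 0 by near: w.
  have /eqP := sq w Ww; rewrite mulf_eq0 (negbTE sw) orbF subr_eq0.
  by move/eqP.
have [[a [Wa fa ea]]|none] := pselect (exists a, [/\ W a, f a <> 0 & s1 a = s2 a]).
  left=> t Wt; have [ft|ft] := pselect (f t = 0).
    by have [-> ->] := s20 t Wt ft.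
  exact: (@loc_const_off_isolated R W _ (fun t => s1 t = s2 t) a t oW cW iZ loc).
right=> t Wt; have [ft|ft] := pselect (f t = 0).
  by have [-> ->] := s20 t Wt ft; rewrite oppr0.
have /eqP := sq t Wt; rewrite mulf_eq0 => /orP[|]; last by rewrite addr_eq0 => /eqP.
by rewrite subr_eq0 => /eqP e; case: none; exists t.
Unshelve. all: by end_near. Qed.

Lemma sqrt_onS W W' f s : W' `<=` W -> sqrt_on W f s -> sqrt_on W' f s.
Proof. by move=> sub S t /sub; exact: S. Qed.

Lemma sqrt_on_opp W f s : sqrt_on W f s -> sqrt_on W f (fun t => - s t).
Proof.
move=> S t Wt; have [c e] := S t Wt; split; first exact: (continuousN c).
by rewrite sqrrN.
Qed.

Lemma convexCI W1 W2 : convexC W1 -> convexC W2 -> convexC (W1 `&` W2).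
Proof. by move=> c1 c2 a b u [a1 a2] [b1 b2] u01; split; [exact: c1|exact: c2]. Qed.

Lemma openCI W1 W2 : openC W1 -> openC W2 -> openC (W1 `&` W2).
Proof. by move=> o1 o2 t [t1 t2]; apply: filterI; [exact: o1|exact: o2]. Qed.

Lemma sqrt_glue W1 W2 f : openC W1 -> convexC W1 -> openC W2 -> convexC W2 ->
  isolated [set t | f t = 0] W1 -> (exists s, sqrt_on W1 f s) ->
  (exists s, sqrt_on W2 f s) -> exists s, sqrt_on (W1 `|` W2) f s.
Proof.
move=> o1 c1 o2 c2 iZ [s1 S1] [s2' S2'].
have [s2 S2 e12] : exists2 s2, sqrt_on W2 f s2 & forall t, W1 t -> W2 t -> s1 t = s2 t.
  have iZ' : isolated [set t | f t = 0] (W1 `&` W2) by move=> t [/iZ].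
  have := sqrt_unique (openCI o1 o2) (convexCI c1 c2) iZ'
    (sqrt_onS (@subIsetl _ _ _) S1) (sqrt_onS (@subIsetr _ _ _) S2').
  case=> H; first by exists s2' => // t t1 t2; exact: H.
  exists (fun t => - s2' t); first exact: sqrt_on_opp.
  by move=> t t1 t2; exact: H.
pose s t := if pselect (W1 t) then s1 t else s2 t.
have sE1 t : W1 t -> s1 t = s t by move=> t1; rewrite /s; case: pselect.
have sE2 t : W2 t -> s2 t = s t.
  by move=> t2; rewrite /s; case: pselect => // t1; rewrite e12.
exists s => t [t1|t2].
  have [c e] := S1 t t1; split; last by rewrite -sE1.
  by apply: continuous_near_eq c; apply: filterS (o1 t t1).
have [c e] := S2 t t2; split; last by rewrite -sE2.
by apply: continuous_near_eq c; apply: filterS (o2 t t2).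
Qed.

Lemma cabs_le_ReIm (z : C) : cabs z <= `|complex.Re z| + `|complex.Im z|.
Proof.
have -> : z = toC (complex.Re z) + 'i%C * toC (complex.Im z) by exact: complexE.
apply: (le_trans (cabsD _ _)); rewrite cabsM !cabs_toC.
rewrite cabs_i mul1r; case: z => x y /=.
by rewrite !mul0r !mul1r !(addr0, add0r, subr0).
Qed.

Definition vstrip (a b : R) : set C := [set t | a < complex.Re t < b].
Definition hstrip (a b : R) : set C := [set t | a < complex.Im t < b].

Lemma Re_lin (a b : C) u :
  complex.Re (seg a b u) = (1 - u) * complex.Re a + u * complex.Re b :> R.
Proof. by case: a b => [a1 a2] [b1 b2]; rewrite /seg /toC /=; ring. Qed.

Lemma Im_lin (a b : C) u :
  complex.Im (seg a b u) = (1 - u) * complex.Im a + u * complex.Im b :> R.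
Proof. by case: a b => [a1 a2] [b1 b2]; rewrite /seg /toC /=; ring. Qed.

Lemma convex_comb_itv (a b x y u : R) : a < x < b -> a < y < b -> 0 <= u <= 1 ->
  a < (1 - u) * x + u * y < b.
Proof.
move=> /andP[ax xb] /andP[ay yb] u01; rewrite convex_comb_lt // andbT.
rewrite -ltrN2 opprD -!mulrN; apply: convex_comb_lt => //; by rewrite ltrN2.
Qed.

Lemma convex_vstrip a b : convexC (vstrip a b).
Proof. by move=> z w u zs ws u01; rewrite /vstrip /= Re_lin; exact: convex_comb_itv. Qed.

Lemma convex_hstrip a b : convexC (hstrip a b).
Proof. by move=> z w u zs ws u01; rewrite /hstrip /= Im_lin; exact: convex_comb_itv. Qed.

Lemma open_vstrip a b : openC (vstrip a b).
Proof.
move=> z /andP[az zb]; apply/nearC.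
exists (Num.min (complex.Re z - a) (b - complex.Re z)).
  by rewrite lt_min !subr_gt0 az.
move=> w; rewrite lt_min => /andP[w1 w2].
have := Re_le_cabs (w - z); rewrite raddfB /= => /ler_normlP[h1 h2].
by apply/andP; split; lra.
Qed.

Lemma open_hstrip a b : openC (hstrip a b).
Proof.
move=> z /andP[az zb]; apply/nearC.
exists (Num.min (complex.Im z - a) (b - complex.Im z)).
  by rewrite lt_min !subr_gt0 az.
move=> w; rewrite lt_min => /andP[w1 w2].
have := Im_le_cabs (w - z); rewrite raddfB /= => /ler_normlP[h1 h2].
by apply/andP; split; lra.
Qed.

Section Global.
Variables (t0 : C) (r : R) (f : C -> C).
Hypothesis r0 : 0 < r.
Let B := ball t0 (toC r).
Hypothesis iZ : isolated [set t | f t = 0] B.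
Hypothesis loc : forall t, B t ->
  exists2 e : R, 0 < e & exists s, sqrt_on (ball t (toC e)) f s.

Let Has W := exists s, sqrt_on W f s.

Let HasS W W' : W' `<=` W -> Has W -> Has W'.
Proof. by move=> sub [s S]; exists s; exact: sqrt_onS S. Qed.

Let has_glue W1 W2 W : openC W1 -> convexC W1 -> openC W2 -> convexC W2 ->
  W1 `<=` B -> W `<=` W1 `|` W2 -> Has W1 -> Has W2 -> Has W.
Proof.
move=> o1 c1 o2 c2 W1B sub H1 H2; apply: (HasS sub); apply: sqrt_glue => //.
by move=> t /W1B; exact: iZ.
Qed.

(** Two inductions over intervals: local roots on small squares are glued along a
    vertical strip, then the strips are glued horizontally.  All pieces are
    intersections of a disc with strips, hence convex, as sqrt_glue requires.
    The smaller radius provides the compactness: a point of the bounding square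
    outside the open disc of radius r has a neighbourhood that misses the
    smaller disc. *)
Lemma sqrt_on_smaller_ball (rho : R) : 0 < rho -> rho < r -> Has (ball t0 (toC rho)).
Proof.
move=> rho0 rhor; pose D := ball t0 (toC rho).
have DB : D `<=` B by move=> t /ballC t1; apply/ballC; apply: lt_trans rhor.
have oD : openC D by exact: open_ballC.
have cD : convexC D by exact: convex_ball.
pose x0 : R := complex.Re t0; pose y0 : R := complex.Im t0.
have inner x : exists2 e : R, 0 < e & Has (D `&` vstrip (x - e) (x + e)).
  pose Q c d := exists2 e : R, 0 < e & Has (D `&` vstrip (x - e) (x + e) `&` hstrip c d).
  have [] := @interval_induction R Q (y0 - rho) (y0 + rho).
  - lra.
  - move=> a b a' b' aa bb [e e0 H]; exists e => //; apply: HasS H.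
    by move=> t [td /andP[t1 t2]]; split=> //; apply/andP; split; lra.
  - move=> a c z b d _ ac cz zb bd [e1 e10 H1] [e2 e20 H2].
    exists (Num.min e1 e2); first by rewrite lt_min e10.
    apply: has_glue H1 H2.
    + by apply: openCI; [apply: openCI => //; exact: open_vstrip|exact: open_hstrip].
    + by apply: convexCI; [apply: convexCI => //; exact: convex_vstrip|exact: convex_hstrip].
    + by apply: openCI; [apply: openCI => //; exact: open_vstrip|exact: open_hstrip].
    + by apply: convexCI; [apply: convexCI => //; exact: convex_vstrip|exact: convex_hstrip].
    + by move=> t [[/DB]].
    + move=> t [[Dt /andP[t1 t2]] /andP[t3 t4]].
      have m1 : Num.min e1 e2 <= e1 by rewrite ge_min lexx.
      have m2 : Num.min e1 e2 <= e2 by rewrite ge_min lexx orbT.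
      have [tb|bt] := ltP (complex.Im t : R) b.
        by left; split; [split=> //; apply/andP; split; lra|apply/andP; split; lra].
      by right; split; [split=> //; apply/andP; split; lra|apply/andP; split; lra].
  - move=> y _; pose z : C := (x +i* y)%C.
    have near_z (e : R) w : vstrip (x - e / 2) (x + e / 2) w ->
        hstrip (y - e / 2) (y + e / 2) w -> cabs (w - z) < e.
      case: w => u v /andP[/= u1 u2] /andP[/= v1 v2].
      apply: (le_lt_trans (cabs_le_ReIm _)) => /=.
      have h1 : `|u - x| < e / 2 by rewrite ltr_distl; apply/andP; split; lra.
      have h2 : `|v - y| < e / 2 by rewrite ltr_distl; apply/andP; split; lra.
      lra.
    have [zr|rz] := ltP (cabs (z - t0)) r.
      have [|e e0 H] := loc (t := z); first exact/ballC.
      exists (e / 2); first lra.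
      exists (e / 2); first lra.
      by apply: HasS H => w [[_ w1] w2]; apply/ballC; exact: near_z.
    exists ((r - rho) / 2); first lra.
    exists ((r - rho) / 2); first lra.
    exists (fun=> 0) => w [[/ballC w0 w1] w2]; exfalso.
    have := near_z _ w w1 w2; have := cabs_trans w z t0; rewrite [cabs (z - w)]cabsB; lra.
  move=> e e0 [e' e'0 H]; exists e' => //; apply: HasS H => w [Dw w1]; split=> //.
  have /ballC Dw' := Dw; have := Im_le_cabs (w - t0); rewrite raddfB /=.
  rewrite -/y0 => /ler_normlP[h1 h2].
  by apply/andP; split; lra.
pose Q a b := Has (D `&` vstrip a b).
have [] := @interval_induction R Q (x0 - rho) (x0 + rho).
- lra.
- move=> a b a' b' aa bb H; apply: HasS H.
  by move=> t [td /andP[t1 t2]]; split=> //; apply/andP; split; lra.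
- move=> a c z b d _ ac cz zb bd H1 H2.
  apply: has_glue H1 H2.
  + by apply: openCI => //; exact: open_vstrip.
  + by apply: convexCI => //; exact: convex_vstrip.
  + by apply: openCI => //; exact: open_vstrip.
  + by apply: convexCI => //; exact: convex_vstrip.
  + by move=> t [/DB].
  + move=> t [Dt /andP[t1 t2]].
    have [tb|bt] := ltP (complex.Re t : R) b.
      by left; split=> //; apply/andP; split; lra.
    by right; split=> //; apply/andP; split; lra.
- by move=> x _; have [e e0 H] := inner x; exists e.
move=> e e0; apply: HasS => w Dw; split=> //.
have /ballC Dw' := Dw; have := Re_le_cabs (w - t0); rewrite raddfB /=.
rewrite -/x0 => /ler_normlP[h1 h2].
by apply/andP; split; lra.
Qed.

(** Exhaust the disc by smaller ones; normalizing all roots on the disc of radius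
    r / 2 makes them agree. *)
Lemma sqrt_on_ball : exists s, sqrt_on B f s.
Proof.
have r0' := r0; pose D rho := ball t0 (toC rho : C).
have DS (rho rho' : R) : rho <= rho' -> D rho `<=` D rho'.
  by move=> h t /ballC t1; apply/ballC; apply: lt_le_trans h.
have iD rho : rho <= r -> isolated [set t | f t = 0] (D rho).
  by move=> h t /(DS _ _ h); exact: iZ.
have [s0 S0] : Has (D (r / 2)).
  apply: sqrt_on_smaller_ball; have := r0; lra.
have [a Da fa] : exists2 a, D (r / 2) a & f a != 0.
  have [|e e0 H] := iZ (t := t0); first by apply/ballC; rewrite subrr cabs0.
  pose m := Num.min (e / 2) (r / 4).
  have m0 : 0 < m by rewrite lt_min; apply/andP; split; lra.
  have me : m < e by apply: (le_lt_trans (y := e / 2)); [rewrite ge_min lexx|lra].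
  have mr : m < r / 2 by apply: (le_lt_trans (y := r / 4)); [rewrite ge_min lexx orbT|lra].
  have E : cabs (t0 + toC m - t0) = m by rewrite [t0 + _]addrC addrK cabs_toC gtr0_norm.
  exists (t0 + toC m); first by apply/ballC; rewrite E.
  apply/eqP; apply: H; rewrite ?E //.
  by rewrite -subr_eq0 [t0 + _]addrC addrK toC_eq0 lt0r_neq0.
have ext rho : exists s, r / 2 <= rho < r ->
    sqrt_on (D rho) f s /\ forall t, D (r / 2) t -> s t = s0 t.
  have [/andP[h1 h2]|] := boolP (r / 2 <= rho < r); last by exists s0.
  have [s S] : Has (D rho).
    apply: sqrt_on_smaller_ball; have := r0; lra.
  have h3 : r / 2 <= r by lra.
  have [] := sqrt_unique (open_ballC (r := r / 2)) (convex_ball (r := r / 2))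
    (iD _ h3) (sqrt_onS (DS _ _ h1) S) S0.
    by move=> H; exists s.
  move=> H; exists (fun t => - s t) => _; split; first exact: sqrt_on_opp.
  by move=> t /H ->; rewrite opprK.
have [S HS] := choice ext.
have agree rho rho' t : r / 2 <= rho -> rho <= rho' -> rho' < r -> D rho t ->
    S rho t = S rho' t.
  move=> h1 h2 h3 Dt.
  have [|S1 e1] := HS rho; first by apply/andP; split; lra.
  have [|S2 e2] := HS rho'; first by apply/andP; split; lra.
  have h4 : rho <= r by lra.
  have [] := sqrt_unique (open_ballC (r := rho)) (convex_ball (r := rho))
    (iD _ h4) S1 (sqrt_onS (DS _ _ h2) S2); first by apply.
  move=> H; have := H a (DS _ _ h1 _ Da); rewrite e1 // e2 // => /eqP.
  rewrite -addr_eq0 -mulr2n mulrn_eq0 /= => /eqP s0a.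
  by move: fa; rewrite -(S0 a Da).2 s0a expr0n eqxx.
pose rad t := (cabs (t - t0) + r) / 2.
have radP t : B t -> [/\ r / 2 <= rad t, rad t < r & D (rad t) t].
  move=> /ballC tr; have := cabs_ge0 (t - t0); rewrite /rad => c0.
  by split; [lra|lra|apply/ballC; lra].
exists (fun t => S (rad t) t) => t Bt; have [r1 r2 Dt] := radP t Bt.
have [|S1 _] := HS (rad t); first by rewrite r1.
have [c e] := S1 t Dt; split; last exact: e.
apply: continuous_near_eq c.
near=> w.
have Dw : D (rad t) w by near: w; exact: open_ballC.
have Bw : B w by near: w; exact: open_ballC.
have [w1 w2 Dw'] := radP w Bw.
have [h|h] := leP (rad t) (rad w); first exact: agree.
by symmetry; apply: agree => //; exact: ltW.
Unshelve. all: by end_near. Qed.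

End Global.

End Sqrt.

(** * Derivatives of square roots and of solutions; zeros of a derivative *)

Section Local.
Variable R : realType.
Local Notation C := (Cplx R).
Implicit Types (f g : C -> C).

Lemma toCN (x : R) : toC (- x) = - toC x :> C. Proof. exact: rmorphN. Qed.

Lemma cstC (k t : C) : {for t, continuous (fun _ : C => k)}.
Proof. exact: cst_continuous. Qed.

Lemma cdiff_near f (psi : C -> C) (t l : C) :
  {for t, continuous psi} -> psi t = l ->
  (\forall s \near t, f s - f t = psi s * (s - t)) -> cdiff f t l.
Proof.
move=> cpsi psit H.
exists (fun s => if s == t then l else (f s - f t) / (s - t)); split.
- apply: continuous_near_eq cpsi; near=> s.
  case: eqP => [->//|/eqP st]; rewrite (near H s) ?mulfK ?subr_eq0 //.
- by rewrite eqxx.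
- move=> s; case: eqP => [->|/eqP st]; first by rewrite !subrr mulr0.
  by rewrite divfK // subr_eq0.
Unshelve. all: by end_near. Qed.

Lemma cdiff_sqrt g f (t l : C) : (\forall s \near t, g s ^+ 2 = f s) ->
  {for t, continuous g} -> g t != 0 -> cdiff f t l -> cdiff g t (l / (2 * g t)).
Proof.
move=> gf cg gt0 [psi [cpsi psit fE]].
have csum : {for t, continuous (fun s => g s + g t)}.
  exact: (continuousD cg (@cstC (g t) t)).
have sum0 : g t + g t != 0 by rewrite -mulr2n mulrn_eq0.
apply: (@cdiff_near _ (fun s => psi s * (g s + g t)^-1)).
- apply: (continuousM cpsi).
  exact: (@continuousV _ _ (fun s => g s + g t) t sum0 csum).
- by rewrite psit mulr_natl mulr2n.
- have gft := nbhs_singleton gf.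
  near=> s.
  have s0 : g s + g t != 0 by near: s; exact: (@continuous_neq0 _ (fun s => g s + g t) t csum sum0).
  rewrite mulrAC -fE -(near gf s) // -gft subr_sqr mulfK //.
Unshelve. all: by end_near. Qed.

(** After division by f t the values lie near 1, where the square root with
    nonnegative real part is continuous: the sum of two such roots stays away
    from 0, so their difference is controlled by the difference of the squares. *)
Lemma local_sqrt f (t : C) : (\forall s \near t, {for s, continuous f}) -> f t != 0 ->
  exists2 e : R, 0 < e & exists s, sqrt_on (ball t (toC e)) f s.
Proof.
move=> cf ft0.
have ct := nbhs_singleton cf.
have sqr_ex z : exists s : C, s ^+ 2 = z /\ 0 <= complex.Re s :> R.
  have [h|h] := leP 0 (complex.Re (sqrtC z) : R).
    by exists (sqrtC z); rewrite sqrtCK.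
  by exists (- sqrtC z); rewrite sqrrN sqrtCK raddfN oppr_ge0 ltW.
have [sg Hsg] := choice sqr_ex.
have ft0' : 0 < cabs (f t) / 2 by rewrite divr_gt0 ?cabs_gt0.
have /nearC[e e0 H] : \forall s \near t, {for s, continuous f} /\ cabs (f s - f t) < cabs (f t) / 2.
  by apply: filterI => //; move/continuousC: ct; exact.
exists e => //; exists (fun w => sqrtC (f t) * sg (f w / f t)) => w /ballC /H[cw fw].
have [sq Re0] := Hsg (f w / f t).
split; last by rewrite exprMn sqrtCK sq mulrC divfK.
have Repos : 0 < complex.Re (sg (f w / f t)) :> R.
  rewrite lt_def Re0 andbT; apply/negP => /eqP Rz.
  have : cabs (f w / f t - 1) < 1 / 2.
    rewrite -[1](mulfV ft0) -mulrBl cabsM cabsV ltr_pdivrMr ?cabs_gt0 //.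
    by move: fw; lra.
  rewrite -sq; case: (sg _) Rz => x y /= ->.
  rewrite expr2 /= => h; have := Re_le_cabs ((0 +i* y)%C * (0 +i* y)%C - 1 : C).
  rewrite /= => /ler_normlP[h1 _]; nra.
apply: (continuousM (@cstC _ w)).
apply/continuousC => eps eps0.
pose m : R := complex.Re (sg (f w / f t)).
have m0 : 0 < eps * (m * cabs (f t)) by rewrite !mulr_gt0 // cabs_gt0.
move/continuousC: cw => /(_ _ m0); apply: filterS => v fv.
have [sqv Rev] := Hsg (f v / f t).
have E : (sg (f v / f t) - sg (f w / f t)) * (sg (f v / f t) + sg (f w / f t)) = (f v - f w) / f t.
  by rewrite -subr_sqr sq sqv mulrBl.
have := congr1 (@cabs R) E; rewrite !cabsM cabsV.
have : m <= cabs (sg (f v / f t) + sg (f w / f t)).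
  have := Re_le_cabs (sg (f v / f t) + sg (f w / f t)).
  rewrite raddfD /= -/m => /(le_trans (ler_norm _)); lra.
move: (cabs_ge0 (sg (f v / f t) - sg (f w / f t))).
set a := cabs (_ - _); set b := cabs (_ + _) => a0 mb ab.
have {}ab : a * b * cabs (f t) = cabs (f v - f w) by rewrite ab divfK // cabs_eq0.
have ft1 : 0 < cabs (f t) by rewrite cabs_gt0.
rewrite -(ltr_pM2r (x := m * cabs (f t))) ?mulr_gt0 //.
apply: le_lt_trans fv; rewrite -ab mulrA ler_pM2r //.
by rewrite ler_wpM2l.
Qed.

(** The difference quotients of f at t are compared with phi t by the mean value
    inequality on the segments that start at t, whose interior avoids t. *)
Lemma cdiff_limit f (phi : C -> C) (t : C) (e : R) : 0 < e ->
  (forall s, cabs (s - t) < e -> {for s, continuous f}) ->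
  (forall s, cabs (s - t) < e -> s != t -> cdiff f s (phi s)) ->
  {for t, continuous phi} -> cdiff f t (phi t).
Proof.
move=> e0 cf df /continuousC cphi.
exists (fun s => if s == t then phi t else (f s - f t) / (s - t)); split.
- apply/continuousC => eps eps0; rewrite eqxx.
  have /cphi /nearC[d d0 H] : 0 < eps / 2 by lra.
  apply/nearC; exists (Num.min d e); first by rewrite lt_min d0.
  move=> s; rewrite lt_min => /andP[sd se].
  case: eqP => [_|/eqP st]; first by rewrite subrr cabs0.
  have st0 : 0 < cabs (s - t) by rewrite cabs_gt0 subr_eq0.
  have dist u : cabs (seg t s u - t) = `|u| * cabs (s - t).
    by rewrite /seg [t + _]addrC addrK cabsM cabs_toC.
  have := @mvt_seg R f phi t s (phi t) (eps / 2).
  have -> : f s - f t - phi t * (s - t) = ((f s - f t) / (s - t) - phi t) * (s - t).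
    by rewrite mulrBl divfK // subr_eq0.
  rewrite cabsM ler_pM2r // => h; apply: (le_lt_trans (h _ _)); last by lra.
    move=> u /andP[u0 u1]; apply: cf; rewrite dist ger0_norm //; nra.
  move=> u /andP[u0 u1].
  have us : cabs (seg t s u - t) < cabs (s - t) by rewrite dist gtr0_norm //; nra.
  split; last by apply: ltW; apply: H; apply: lt_trans sd.
  apply: df; first exact: lt_trans se.
  by rewrite -subr_eq0 -cabs_eq0 dist mulf_neq0 ?normr_eq0 ?lt0r_neq0.
- by rewrite eqxx.
- move=> s; case: eqP => [->|/eqP st]; first by rewrite !subrr mulr0.
  by rewrite divfK // subr_eq0.
Qed.

(** The maximum of F on [0, 1] lies in the interior, because F increases at 0
    and decreases at 1. *)
Lemma darboux01 (F d : R -> R) :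
  (forall u : R, 0 <= u <= 1 -> is_derive u 1 F (d u)) -> 0 < d 0 -> d 1 < 0 ->
  exists2 c, 0 < c < 1 & d c = 0.
Proof.
move=> dF d0 d1.
have cF : {within `[0, 1], continuous F}.
  apply/continuous_in_subspaceT => u; rewrite inE /= in_itv /= => /dF /is_derive_cdiff.
  exact: cdiff_continuous.
have [c] := EVT_max ler01 cF.
rewrite in_itv /= => c01 Hmax.
have mx t : 0 <= t <= 1 -> F t <= F c by move=> h; apply: Hmax; rewrite in_itv.
have c0 : c != 0.
  apply/eqP => cz; have h01 : ((0 : R) <= 0) && ((0 : R) <= 1) by rewrite ?lexx ?ler01.
  have /is_derive_cdiff[psi [cpsi psi0 FE]] := dF _ h01.
  have /nbhs_ballP[e /= e0 H] : \forall u \near 0, 0 < psi u.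
    by apply: (cvgr_gt _ cpsi); rewrite psi0.
  pose u := Num.min (e / 2) (1 / 2).
  have u0 : 0 < u by rewrite lt_min; apply/andP; split; lra.
  have ue : u < e by apply: (le_lt_trans (y := e / 2)); [rewrite ge_min lexx|lra].
  have u1 : u <= 1 / 2 by rewrite ge_min lexx orbT.
  have pu : 0 < psi u.
    by apply: H; rewrite -ball_normE /ball_ /= sub0r normrN gtr0_norm.
  have /mx : 0 <= u <= 1 by apply/andP; split; lra.
  by rewrite cz -subr_le0 FE subr0; apply/negP; rewrite -ltNge mulr_gt0.
have c1 : c != 1.
  apply/eqP => cz; have h01 : ((0 : R) <= 1) && ((1 : R) <= 1) by rewrite ?lexx ?ler01.
  have /is_derive_cdiff[psi [cpsi psi1 FE]] := dF _ h01.
  have /nbhs_ballP[e /= e0 H] : \forall u \near (1 : R), psi u < 0.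
    by apply: (cvgr_lt _ cpsi); rewrite psi1.
  pose u := Num.min (e / 2) (1 / 2).
  have u0 : 0 < u by rewrite lt_min; apply/andP; split; lra.
  have ue : u < e by apply: (le_lt_trans (y := e / 2)); [rewrite ge_min lexx|lra].
  have u1 : u <= 1 / 2 by rewrite ge_min lexx orbT.
  have pu : psi (1 - u) < 0.
    by apply: H; rewrite -ball_normE /ball_ /= opprB addrC subrK gtr0_norm.
  have /mx : 0 <= 1 - u <= 1 by apply/andP; split; lra.
  rewrite cz -subr_le0 FE; apply/negP; rewrite -ltNge; nra.
have c01' : 0 < c < 1.
  by case/andP: c01 => h0 h1; rewrite !lt_def c0 h0 eq_sym c1.
exists c => //.
have D : is_derive c 1 F 0.
  apply: (@derive1_at_max _ F 0 1) => //.
  - move=> u; rewrite in_itv /= => /andP[u0 u1].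
    by have [] := dF u _; rewrite ?ltW.
  - by move=> u; rewrite in_itv /= => /andP[u0 u1]; apply: mx; rewrite !ltW.
have D' := dF c c01.
by case: D => _ <-; case: D' => _ ->.
Qed.

(** Near a point with g t nonzero the quotient g s / g t has square near 1, so it
    is near 1 or near -1.  The second case is excluded by the intermediate value
    property of the derivative of the real function Re (k f) along the segment
    from t to s, with k normalizing that derivative to Re (g s / g t). *)
Lemma derivative_continuous f g (t : C) : (\forall s \near t, cdiff f s (g s)) ->
  {for t, continuous (fun s => g s ^+ 2)} -> {for t, continuous g}.
Proof.
move=> df /continuousC cg2.
have [gt0|gt0] := eqVneq (g t) 0.
  apply/continuousC => e e0; have := cg2 (e ^+ 2) (exprn_gt0 _ e0).
  apply: filterS => s; rewrite gt0 expr0n !subr0 !expr2 cabsM => h.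
  by rewrite ltNge; apply/negP => h'; move: h; rewrite ltNge ler_pM // ltW.
have gt1 : 0 < cabs (g t) by rewrite cabs_gt0.
pose q s := g s / g t.
have q2 (e : R) : 0 < e -> \forall s \near t, cabs (q s ^+ 2 - 1) < e.
  move=> e0; have := cg2 (e * cabs (g t) ^+ 2); rewrite mulr_gt0 ?exprn_gt0 // => /(_ isT).
  apply: filterS => s h; rewrite /q expr_div_n.
  rewrite -[1](mulfV (expf_neq0 2 gt0)) -mulrBl cabsM cabsV -[cabs (g t ^+ 2)]/(cabs (g t * g t)) cabsM -expr2.
  by rewrite ltr_pdivrMr ?exprn_gt0.
have /nearC[e e0 H] : \forall s \near t, cdiff f s (g s) /\ cabs (q s ^+ 2 - 1) < 1.
  by apply: filterI => //; apply: q2.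
have Req0 s : cabs (s - t) < e -> complex.Re (q s) != 0 :> R.
  move=> /H[_]; apply: contraTneq; case: (q s) => x y /= ->.
  rewrite -leNgt; apply: le_trans (Re_le_cabs _).
  rewrite (_ : complex.Re _ = - (y ^+ 2) - 1).
    by rewrite -opprD normrN ger0_norm ?addr_ge0 ?sqr_ge0 // lerDr sqr_ge0.
  by rewrite expr2 /=; ring.
have Repos s : cabs (s - t) < e -> 0 < complex.Re (q s) :> R.
  move=> se; rewrite ltNge; apply/negP; rewrite le_eqVlt (negbTE (Req0 s se)) /= => neg.
  have [st|st] := eqVneq s t.
    by move: neg; rewrite st /q mulfV //= ltr10.
  have inb u : 0 <= u <= 1 -> cabs (seg t s u - t) < e.
    by move=> u01; apply: cabs_seg => //; rewrite subrr cabs0.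
  (* along the segment from t to s, Re (k f) has derivative Re (g / g t) *)
  pose k := (g t * (s - t))^-1.
  have kE z : k * z * (s - t) = z / g t.
    by rewrite /k invfM mulrAC mulrC -!mulrA mulVf ?subr_eq0 // mulr1 mulrC.
  have [|||c /andP[c0 c1]] := @darboux01
    (fun u => complex.Re (k * f (seg t s u))) (fun u => complex.Re (q (seg t s u))).
  - move=> u u01; rewrite /q -kE; apply: cdiff_seg.
    exact: (H _ (inb u u01)).1.
  - by rewrite seg0 /q mulfV.
  - by rewrite seg1.
  - by move=> /eqP; apply/negP; apply: Req0; apply: inb; rewrite !ltW.
apply/continuousC => eps eps0.
have := q2 (eps / cabs (g t)); rewrite divr_gt0 // => /(_ isT) h.
near=> s.
have se : cabs (s - t) < e by apply/ballC; near: s; apply: open_ballC; apply/ballC; rewrite subrr cabs0.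
have : cabs (q s ^+ 2 - 1) < eps / cabs (g t) by near: s.
rewrite subr_sqr_1 cabsM ltr_pdivlMr // mulrAC -cabsM mulrBl divfK // mul1r.
apply: le_lt_trans; rewrite ler_peMr ?cabs_ge0 //.
have := Re_le_cabs (q s + 1); rewrite raddfD /= => /(le_trans (ler_norm _)).
by have := Repos s se; lra.
Unshelve. all: by end_near. Qed.

(** The determinant of z and w as vectors of the real plane. *)
Definition cross (z w : C) : R := complex.Re z * complex.Im w - complex.Im z * complex.Re w.

Lemma cross_le (z w : C) : `|cross z w| <= cabs z * cabs w.
Proof.
have -> : cabs z = cabs (z^*)%C by rewrite /cabs normcJ.
rewrite -cabsM; have -> : cross z w = complex.Im ((z^*)%C * w).
  by case: z => a b; case: w => c d; rewrite /cross /=; ring.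
exact: Im_le_cabs.
Qed.

Lemma seg_seg (a b : C) (u v : R) : seg a (seg a b u) v = seg a b (v * u).
Proof. rewrite /seg toCM; ring. Qed.

(** The infimum of the parameters at which g vanishes; the zero set is closed. *)
Lemma first_zero g (a b : C) :
  (forall u : R, 0 <= u <= 1 -> {for seg a b u, continuous g}) ->
  g a != 0 -> g b = 0 ->
  exists u : R, [/\ 0 < u <= 1, g (seg a b u) = 0 &
    forall v : R, 0 <= v < u -> g (seg a b v) != 0].
Proof.
move=> cg ga gb.
pose S := [set u : R | 0 <= u <= 1 /\ g (seg a b u) = 0].
have S1 : S 1 by split; [rewrite ler01 lexx|rewrite seg1].
have Slb : lbound S 0 by move=> u [/andP[]].
have Sinf : has_inf S by split; [exists 1|exists 0].
pose m := inf S.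
have m0 : 0 <= m by apply: lb_le_inf => //; exists 1.
have m1 : m <= 1 by apply: ge_inf => //; exists 0.
have m01 : 0 <= m <= 1 by rewrite m0 m1.
have gm : g (seg a b m) = 0.
  apply/eqP; apply/negPn/negP => gm.
  have c : {for m, continuous (fun u => g (seg a b u))}.
    apply: (@continuous_comp _ _ _ (seg a b) g); first exact: continuous_seg.
    exact: cg.
  have : \forall z \near seg a b m, g z != 0 by apply: continuous_neq0 gm; exact: cg.
  move=> /(@continuous_seg _ a b m) /nbhs_ballP[e /= e0 H].
  have [u [u01 gu] ue] := inf_adherent e0 Sinf.
  have mu : m <= u by apply: ge_inf; [exists 0|split].
  have F : g (seg a b u) != 0.
    apply: (H u); rewrite -ball_normE /ball_ /= distrC ger0_norm ?subr_ge0 //.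
    by move: ue; rewrite -/m; lra.
  by move: F; rewrite gu eqxx.
exists m; split=> //.
  rewrite m1 andbT lt_def m0 andbT; apply: contraNneq ga => mz.
  by rewrite -(seg0 a b) -mz gm.
move=> v /andP[v0 vm]; apply/eqP => gv.
have : m <= v by apply: ge_inf; [exists 0|split=> //; rewrite v0 /=; lra].
lra.
Qed.

Section Zeros.
Variables (g phi : C -> C) (F0 : C).

(** Up to the first zero on the way from s, the function g is nearly affine with
    slope F0.  Hence each of the two first zeros is nearly s - g s / F0, and they
    are close to each other in comparison with their distances to s. *)
Lemma visible_zeros (D : set C) (eta : R) s a b : convexC D ->
  (forall z, D z -> {for z, continuous g}) ->
  (forall z, D z -> g z != 0 -> cdiff g z (phi z)) ->
  (forall z, D z -> cabs (phi z - F0) <= eta) ->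
  D s -> D a -> D b -> g s != 0 -> g a = 0 -> g b = 0 ->
  exists al be : R, [/\ 0 < al <= 1, 0 < be <= 1 &
    cabs F0 * cabs (toC al * (a - s) - toC be * (b - s))
      <= eta * (al * cabs (a - s) + be * cabs (b - s))].
Proof.
move=> cD cg dg bd Ds Da Db gs ga gb.
have one c : D c -> g c = 0 -> exists2 al : R, 0 < al <= 1 &
    cabs (- g s - F0 * (toC al * (c - s))) <= eta * (al * cabs (c - s)).
  move=> Dc gc.
  have [u [u01 gu nz]] : exists u : R, [/\ 0 < u <= 1, g (seg s c u) = 0 &
      forall v : R, 0 <= v < u -> g (seg s c v) != 0].
    by apply: first_zero => // u u01; apply: cg; exact: cD.
  have /andP[u0 u1] := u01.
  have Du v : 0 <= v <= 1 -> D (seg s (seg s c u) v).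
    move=> /andP[v0 v1]; rewrite seg_seg; apply: cD => //; apply/andP; split; nra.
  exists u => //.
  have E : seg s c u - s = toC u * (c - s) by rewrite /seg [s + _]addrC addrK.
  have := @mvt_seg R g phi s (seg s c u) F0 eta.
  rewrite gu sub0r E cabsM cabs_toC gtr0_norm // => H; apply: H.
    by move=> v v01; apply: cg; exact: Du.
  move=> v /andP[v0 v1].
  have Dv : D (seg s (seg s c u) v) by apply: Du; rewrite !ltW.
  split; last exact: bd.
  apply: dg => //; rewrite seg_seg; apply: nz; apply/andP; split; nra.
have [al al01 Ha] := one a Da ga; have [be be01 Hb] := one b Db gb.
exists al, be; split=> //; rewrite -cabsM.
have -> : F0 * (toC al * (a - s) - toC be * (b - s)) =
   (- g s - F0 * (toC be * (b - s))) - (- g s - F0 * (toC al * (a - s))) by ring.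
apply: (le_trans (cabsD _ _)); rewrite cabsN; move: Ha Hb; lra.
Qed.

Variables (t : C) (e : R).
Hypothesis e0 : 0 < e.
Hypothesis F00 : F0 != 0.
Let D := ball t (toC e).
Hypothesis cg : forall z, D z -> {for z, continuous g}.
Hypothesis cphi : forall z, D z -> g z = 0 -> {for z, continuous phi}.
Hypothesis dg : forall z, D z -> g z != 0 -> cdiff g z (phi z).
Hypothesis phi0 : forall z, D z -> g z = 0 -> phi z = F0.
Hypothesis gt : g t = 0.

(** The derivative of g where g is nonzero is phi, and phi takes the value F0 at
    all zeros of g.  On a disc where phi stays within |F0| / 2 of F0, a segment
    between two zeros contains only zeros: from a point between them where g is nonzero the
    first zeros on both sides would be too close.  Suppose that the disc contains
    a zero u besides t and also a point s1 with g s1 nonzero, which may be moved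
    off the line through t and u.  Let us be the first zero from s1 to u.  The segment from us
    to t consists of zeros, so points just before us on the way from s1 see zeros
    in two directions whose angle does not shrink, while near us the slope of g
    is arbitrarily close to F0; this contradicts visible_zeros. *)
Lemma zeros_dichotomy : exists2 d : R, 0 < d &
  (forall s, cabs (s - t) < d -> s != t -> g s != 0) \/
  (forall s, cabs (s - t) < d -> g s = 0).
Proof.
have Dt : D t by apply/ballC; rewrite subrr cabs0.
have cF0 : 0 < cabs F0 by rewrite cabs_gt0.
have loc c (eta : R) : D c -> g c = 0 -> 0 < eta -> exists2 d : R, 0 < d &
    forall z, cabs (z - c) < d -> D z /\ cabs (phi z - F0) <= eta.
  move=> Dc gc eta0; apply/nearC; near=> z; split.
    by near: z; exact: open_ballC.
  apply: ltW; near: z; rewrite -(phi0 Dc gc).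
  by have /continuousC := cphi Dc gc; exact.
have [|d d0 Hd] := loc t (cabs F0 / 2) Dt gt; first by rewrite divr_gt0.
pose Dd := ball t (toC d).
have cDd : convexC Dd by exact: convex_ball.
have DdD z : Dd z -> D z by move=> /ballC /Hd[].
have gap a b (u : R) : Dd a -> Dd b -> g a = 0 -> g b = 0 -> 0 <= u <= 1 ->
    g (seg a b u) = 0.
  move=> Da Db ga gb u01; have /andP[u0 u1] := u01.
  apply/eqP; apply/negPn/negP => gm; set m := seg a b u in gm.
  have [al [be []]] := @visible_zeros Dd (cabs F0 / 2) m a b cDd
    (fun z Dz => cg (DdD z Dz)) (fun z Dz => dg (DdD z Dz))
    (fun z Dz => (Hd z ((ballC _ _ _).1 Dz)).2) (cDd _ _ _ Da Db u01) Da Db gm ga gb.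
  move=> /andP[al0 _] /andP[be0 _].
  have ab : 0 < cabs (b - a).
    rewrite cabs_gt0 subr_eq0; apply: contraNneq gm => ab.
    by rewrite /m /seg ab subrr mulr0 addr0 ga.
  have -> : a - m = toC (- u) * (b - a) by rewrite /m /seg toCN; ring.
  have -> : b - m = toC (1 - u) * (b - a) by rewrite /m /seg toCB toC1; ring.
  have -> : toC al * (toC (- u) * (b - a)) - toC be * (toC (1 - u) * (b - a))
     = toC (- (al * u + be * (1 - u))) * (b - a).
    by rewrite !(toCN, toCD, toCM, toC1); ring.
  have S0 : 0 < al * u + be * (1 - u) by have [|] := ltP u (1 / 2); nra.
  have n1 : `|- u| = u by rewrite normrN ger0_norm.
  have n2 : `|1 - u| = 1 - u by rewrite ger0_norm // subr_ge0.
  have n3 : `|- (al * u + be * (1 - u))| = al * u + be * (1 - u).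
    by rewrite normrN gtr0_norm.
  rewrite !cabsM !cabs_toC n1 n2 n3.
  have := mulr_gt0 S0 ab.
  have -> : al * (u * cabs (b - a)) + be * ((1 - u) * cabs (b - a))
    = (al * u + be * (1 - u)) * cabs (b - a) by ring.
  by nra.
have [|notA] := pselect (forall s, cabs (s - t) < d -> s != t -> g s != 0).
  by exists d => //; left.
have [|notB] := pselect (forall s, cabs (s - t) < d -> g s = 0).
  by exists d => //; right.
exfalso.
have [u [Du ut gu]] : exists u, [/\ Dd u, u != t & g u = 0].
  apply: contrapT => none; apply: notA => s sd st; apply/eqP => gs.
  by apply: none; exists s; split=> //; apply/ballC.
have [s0 [Ds0 gs0]] : exists s0, Dd s0 /\ g s0 != 0.
  apply: contrapT => none; apply: notB => s sd; apply: contrapT => /eqP gs.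
  by apply: none; exists s; split=> //; apply/ballC.
have [s1 [Ds1 gs1 X1]] : exists s1, [/\ Dd s1, g s1 != 0 & cross (u - t) (s1 - t) != 0].
  have [X0|] := eqVneq (cross (u - t) (s0 - t)) 0; last by exists s0.
  have /nearC[e1 e10 H] : \forall z \near s0, Dd z /\ g z != 0.
    apply: filterI; first exact: open_ballC.
    by apply: continuous_neq0 gs0; apply: cg; exact: DdD.
  have ut0 : 0 < cabs (u - t) by rewrite cabs_gt0 subr_eq0.
  (* a shift of length e1 / 2 orthogonal to u - t *)
  pose ka := e1 / (2 * cabs (u - t)).
  have ka0 : 0 < ka by rewrite divr_gt0 // mulr_gt0.
  pose s1 := s0 + toC ka * ('i%C * (u - t)).
  have [|D1 g1] := H s1.
    rewrite /s1 [s0 + _]addrC addrK !cabsM cabs_toC gtr0_norm // cabs_i mul1r.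
    rewrite /ka invfM mulrA divfK ?gt_eqF //; lra.
  exists s1; split=> //.
  have -> : cross (u - t) (s1 - t) = cross (u - t) (s0 - t)
      + ka * (complex.Re (u - t) ^+ 2 + complex.Im (u - t) ^+ 2).
    rewrite /s1 addrAC; case: (u - t) => x y; case: (s0 - t) => x' y'.
    by rewrite /cross /=; ring.
  rewrite X0 add0r mulf_neq0 ?gt_eqF // lt_def addr_ge0 ?sqr_ge0 // andbT.
  rewrite paddr_eq0 ?sqr_ge0 // !sqrf_eq0; move: ut; rewrite -subr_eq0.
  apply: contra => /andP[/eqP h1 /eqP h2]; apply/eqP.
  by case: (u - t) h1 h2 => x y /= -> ->.
have [|al0 [/andP[al00 al01] gus nz]] := @first_zero g s1 u _ gs1 gu.
  by move=> v v01; apply: cg; apply: DdD; exact: cDd.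
set us := seg s1 u al0 in gus.
have Dus : Dd us by apply: cDd => //; rewrite ltW.
pose dd := us - s1; pose k := t - us.
have X0 : cross dd k != 0.
  have -> : cross dd k = - (al0 * cross (u - t) (s1 - t)).
    rewrite /k /dd /us /seg; case: (s1) (u) (t) => [a1 a2] [b1 b2] [c1 c2].
    by rewrite /cross /=; ring.
  by rewrite oppr_eq0 mulf_neq0 // gt_eqF.
pose X := `|cross dd k|.
have Xpos : 0 < X by rewrite normr_gt0.
have eq_ler (x y : R) : x = y -> x <= y by move=> ->.
have crossE (al be : R) : 0 < al -> 0 < be ->
    al * X <= cabs (dd + k) * cabs (toC al * dd - toC be * (dd + k)) /\
    be * X <= cabs dd * cabs (toC al * dd - toC be * (dd + k)).
  move=> al_gt0 be_gt0; split; apply: le_trans (cross_le _ _); rewrite /X.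
    rewrite -[al in al * _]gtr0_norm // -normrM -normrN.
    apply: eq_ler; congr (`|_|); case: (dd) (k) => [a b] [c d'].
    by rewrite /cross /=; ring.
  rewrite -[be in be * _]gtr0_norm // -normrM -normrN.
  apply: eq_ler; congr (`|_|); case: (dd) (k) => [a b] [c d'].
  by rewrite /cross /=; ring.
have dd0 : 0 < cabs dd.
  by rewrite cabs_gt0; apply: contraNneq X0 => ->; rewrite /cross /=; apply/eqP; ring.
have dk0 : 0 < cabs (dd + k).
  rewrite cabs_gt0; apply: contraNneq X0 => /eqP; rewrite addr_eq0 => /eqP ->.
  by case: (k) => a b; rewrite /cross /=; apply/eqP; ring.
(* small enough that visible_zeros contradicts the lower bound crossE given by
   the angle between dd and k *)
pose eta := cabs F0 * X / (4 * (cabs dd * cabs (dd + k))).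
have eta0 : 0 < eta by rewrite divr_gt0 ?mulr_gt0.
have [de de0 Hde] := loc us eta (DdD _ Dus) gus eta0.
pose De := ball us (toC de).
pose ep := Num.min 1 (de / (2 * (cabs dd + cabs k + 1))).
have big0 : 0 < 2 * (cabs dd + cabs k + 1) by have := cabs_ge0 k; lra.
have ep0 : 0 < ep by rewrite lt_min ltr01 divr_gt0.
have ep1 : ep <= 1 by rewrite ge_min lexx.
have epd : ep * (2 * (cabs dd + cabs k + 1)) <= de.
  by rewrite -ler_pdivlMr // ge_min lexx orbT.
pose s := seg s1 u (al0 * (1 - ep)).
have sE : s = us - toC ep * dd.
  by rewrite /s /dd /us /seg toCM toCB toC1; ring.
have gs : g s != 0 by apply: nz; apply/andP; split; nra.
pose v := seg us t ep.
have gv : g v = 0.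
  apply: gap => //; first by apply/ballC; rewrite subrr cabs0.
  by rewrite ltW.
have Dus' : De us by apply/ballC; rewrite subrr cabs0.
have Dv : De v.
  apply/ballC; rewrite /v /seg [us + _]addrC addrK cabsM cabs_toC gtr0_norm // -/k.
  have := cabs_ge0 k; nra.
have Ds : De s.
  apply/ballC; rewrite sE [us - _]addrC addrK cabsN cabsM cabs_toC gtr0_norm //.
  have := cabs_ge0 k; nra.
have [al [be [/andP[alp _] /andP[bep _]]]] := @visible_zeros De eta s us v (convex_ball (r := de))
    (fun z Dz => cg (Hde z ((ballC _ _ _).1 Dz)).1)
    (fun z Dz => dg (Hde z ((ballC _ _ _).1 Dz)).1)
    (fun z Dz => (Hde z ((ballC _ _ _).1 Dz)).2) Ds Dus' Dv gs gus gv.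
have -> : us - s = toC ep * dd by rewrite sE; ring.
have -> : v - s = toC ep * (dd + k) by rewrite sE /v /seg /k; ring.
have -> : toC al * (toC ep * dd) - toC be * (toC ep * (dd + k))
   = toC ep * (toC al * dd - toC be * (dd + k)) by ring.
rewrite !cabsM !cabs_toC !gtr0_norm //.
have [] := crossE al be alp bep; set N := cabs (_ - _) => h1 h2 h3.
have N0 : 0 < N.
  rewrite -(pmulr_rgt0 _ dk0); apply: lt_le_trans h1; exact: mulr_gt0.
have h3' : cabs F0 * N <= eta * (al * cabs dd + be * cabs (dd + k)).
  rewrite -(ler_pM2l ep0); apply: le_trans (le_trans h3 _); first by apply: eq_ler; ring.
  by apply: eq_ler; ring.
have h4 : (al * cabs dd + be * cabs (dd + k)) * X <= 2 * (cabs dd * cabs (dd + k)) * N.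
  have g1 : al * X * cabs dd <= cabs (dd + k) * N * cabs dd by rewrite ler_pM2r.
  have g2 : be * X * cabs (dd + k) <= cabs dd * N * cabs (dd + k) by rewrite ler_pM2r.
  move: g1 g2; nra.
have h5 : eta * (al * cabs dd + be * cabs (dd + k)) <= cabs F0 * N / 2.
  rewrite /eta; set Q := al * cabs dd + _ in h4 *.
  have -> : cabs F0 * X / (4 * (cabs dd * cabs (dd + k))) * Q
     = cabs F0 * (Q * X) / (4 * (cabs dd * cabs (dd + k))) by ring.
  rewrite ler_pdivrMr ?mulr_gt0 //.
  have -> : cabs F0 * N / 2 * (4 * (cabs dd * cabs (dd + k))) =
    cabs F0 * (2 * (cabs dd * cabs (dd + k)) * N) by field.
  by rewrite ler_pM2l.
have : 0 < cabs F0 * N by rewrite mulr_gt0.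
lra.
Unshelve. all: by end_near. Qed.

End Zeros.

End Local.

(** * Solutions of Y'^2 = D(Y) *)

Section Solution.
Variable R : realType.
Local Notation C := (Cplx R).

(** On a disc of radius at most 1 / (2 K) the mean value inequality shows that the
    supremum of |f| is at most half of itself. *)
Lemma gronwall_zero (f g : C -> C) (t : C) (e K : R) : 0 < e -> f t = 0 ->
  (forall s, cabs (s - t) < e -> cdiff f s (g s) /\ cabs (g s) <= K * cabs (f s)) ->
  exists2 d : R, 0 < d & forall s, cabs (s - t) < d -> f s = 0.
Proof.
move=> e0 ft H.
have ct : {for t, continuous f}.
  have [|h _] := H t; first by rewrite subrr cabs0.
  exact: cdiff_continuous h.
have /nearC[d1 d10 H1] : \forall s \near t, cabs (f s) < 1.
  by move/continuousC: ct => /(_ 1 ltr01); rewrite ft; apply: filterS => s; rewrite subr0.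
pose K1 := Num.max K 1.
have K10 : 0 < K1 by rewrite lt_max ltr01 orbT.
have KK1 : K <= K1 by rewrite le_max lexx.
pose d := Num.min (Num.min e d1) (1 / (2 * K1)).
have d0 : 0 < d by rewrite !lt_min e0 d10 divr_gt0 ?mulr_gt0.
have de : d <= e by rewrite !ge_min lexx.
have dd1 : d <= d1 by rewrite !ge_min lexx orbT.
have dK : d * (2 * K1) <= 1 by rewrite -ler_pdivlMr ?mulr_gt0 // ge_min lexx orbT.
exists d => //.
pose S := [set x : R | exists2 s, cabs (s - t) < d & x = cabs (f s)].
have S0 : S 0 by exists t; rewrite ?subrr ?ft cabs0.
have Sub : has_sup S.
  split; first by exists 0.
  by exists 1 => _ [s sd ->]; apply/ltW/H1; exact: lt_le_trans dd1.
pose M := sup S.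
have leM s : cabs (s - t) < d -> cabs (f s) <= M.
  by move=> sd; apply: ub_le_sup; [exact: Sub.2|exists s].
have M0 : 0 <= M by apply: ub_le_sup; [exact: Sub.2|].
have half s : cabs (s - t) < d -> cabs (f s) <= M / 2.
  move=> sd.
  have inb u : 0 <= u <= 1 -> cabs (seg t s u - t) < d.
    by move=> u01; apply: cabs_seg => //; rewrite subrr cabs0.
  have := @mvt_seg R f g t s 0 (K1 * M).
  rewrite mul0r subr0 ft subr0 => h; apply: le_trans (h _ _) _.
  - move=> u /inb us; have [|D _] := H (seg t s u); first exact: lt_le_trans de.
    exact: cdiff_continuous D.
  - move=> u /andP[u0 u1].
    have us : cabs (seg t s u - t) < d by apply: inb; rewrite !ltW.
    have [|D b] := H (seg t s u); first exact: lt_le_trans de.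
    split=> //; rewrite subr0; apply: (le_trans b).
    apply: (le_trans (ler_wpM2r (cabs_ge0 _) KK1)).
    by rewrite ler_wpM2l ?leM // ltW.
  - have : K1 * M * cabs (s - t) <= K1 * M * d.
      by rewrite ler_wpM2l ?mulr_ge0 // ltW.
    have : M * (d * (2 * K1)) <= M * 1 by rewrite ler_wpM2l.
    lra.
have : M <= M / 2 by apply: ge_sup => [|_ [s sd ->]]; [exists 0|exact: half].
move=> Mh s /leM h; apply/eqP; rewrite -cabs_eq0 eq_le cabs_ge0 andbT; lra.
Qed.

Lemma continuous_prod (I : Type) (r : seq I) (P : pred I) (F : I -> C -> C) (t : C) :
  (forall i, P i -> {for t, continuous (F i)}) ->
  {for t, continuous (fun s => \prod_(i <- r | P i) F i s)}.
Proof.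
move=> cF; elim: r => [|i r IH].
  have -> : (fun s => \prod_(i <- [::] | P i) F i s) = (fun=> 1).
    by apply: funext => s; rewrite big_nil.
  exact: cstC.
have [Pi|nPi] := boolP (P i).
  have -> : (fun s => \prod_(j <- i :: r | P j) F j s)
      = (fun s => F i s * \prod_(j <- r | P j) F j s).
    by apply: funext => s; rewrite big_cons Pi.
  exact: (continuousM (cF i Pi) IH).
have -> : (fun s => \prod_(j <- i :: r | P j) F j s)
    = (fun s => \prod_(j <- r | P j) F j s).
  by apply: funext => s; rewrite big_cons (negbTE nPi).
exact: IH.
Qed.

Lemma continuous_horner_comp (D : {poly C}) (Y : C -> C) (t : C) :
  {for t, continuous Y} -> {for t, continuous (fun s => D.[Y s])}.
Proof.
move=> cY; elim/poly_ind: D => [|D c IH].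
  have -> : (fun s => (0 : {poly C}).[Y s]) = (fun=> 0).
    by apply: funext => s; rewrite horner0.
  exact: cstC.
have -> : (fun s => (D * 'X + c%:P).[Y s]) = (fun s => D.[Y s] * Y s + c).
  by apply: funext => s; rewrite hornerMXaddC.
by apply: continuousD; [exact: (continuousM IH cY)|exact: cstC].
Qed.

(** E is the difference quotient of D at a, whose value at a is the derivative. *)
Lemma root_factor (D : {poly C}) (a : C) :
  exists E : {poly C}, D = (D.[a])%:P + ('X - a%:P) * E /\ E.[a] = (D^`()).[a].
Proof.
have : root (D - (D.[a])%:P) a by rewrite /root hornerD hornerN hornerC subrr.
move=> /factor_theorem[E EE]; exists E.
have DE : D = (D.[a])%:P + ('X - a%:P) * E by rewrite mulrC -EE addrC subrK.
split=> //; rewrite [in RHS]DE derivD derivC add0r derivM derivXsubC mul1r.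
by rewrite hornerD hornerM hornerXsubC subrr mul0r addr0.
Qed.

Lemma cdiff_horner (D : {poly C}) (Y : C -> C) (t l : C) :
  cdiff Y t l -> cdiff (fun s => D.[Y s]) t ((D^`()).[Y t] * l).
Proof.
move=> dY; have cY := cdiff_continuous dY.
have [psi [cpsi psit YE]] := dY.
have [E [DE Ea]] := root_factor D (Y t).
exists (fun s => E.[Y s] * psi s); split.
- apply: (@continuousM _ _ (fun s => E.[Y s]) psi t _ cpsi).
  exact: (@continuous_horner_comp E Y t cY).
- by rewrite Ea psit.
- move=> s; rewrite {1}DE hornerD hornerC hornerM hornerXsubC YE; ring.
Qed.

Variables (t0 : C) (r : R) (Y g : C -> C) (D : {poly C}).
Let B := ball t0 (toC r).
Hypothesis dY : forall t, B t -> cdiff Y t (g t).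
Hypothesis gD : forall t, B t -> g t ^+ 2 = D.[Y t].
Hypothesis nonconst : exists s t, [/\ B s, B t & Y s <> Y t].

Let oB : openC B. Proof. exact: open_ballC. Qed.
Let cB : convexC B. Proof. exact: convex_ball. Qed.

Let cY t : B t -> {for t, continuous Y}.
Proof. by move=> /dY; exact: cdiff_continuous. Qed.

Lemma solution_derivative_continuous t : B t -> {for t, continuous g}.
Proof.
move=> Bt; apply: (@derivative_continuous _ Y).
  by apply: filterS (oB Bt) => s; exact: dY.
apply: (@continuous_near_eq _ (fun s => D.[Y s])).
  by apply: filterS (oB Bt) => s Bs; rewrite gD.
exact: (@continuous_horner_comp D Y t (cY Bt)).
Qed.

Let gvanish (t : C) := \forall s \near t, g s = 0.

(** Here D = (x - y)^2 E, so |Y'| is at most a multiple of |Y - y|. *)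
Lemma double_root_vanish t : B t -> D.[Y t] = 0 -> (D^`()).[Y t] = 0 -> gvanish t.
Proof.
move=> Bt D0 D'0; set y := Y t in D0 D'0 *.
have [E1 [DE1 E1y]] := root_factor D y.
have [E2 [DE2 _]] := root_factor E1 y.
have DE x : D.[x] = (x - y) ^+ 2 * E2.[x].
  rewrite DE1 D0 add0r hornerM DE2 E1y D'0 add0r hornerM hornerXsubC; ring.
pose K2 := cabs (E2.[y]) + 1.
have K20 : 0 < K2 by have := cabs_ge0 E2.[y]; rewrite /K2; lra.
have cE := @continuous_horner_comp E2 Y t (cY Bt).
have /nearC[e e0 He] : \forall s \near t, B s /\ cabs (E2.[Y s]) <= K2.
  apply: filterI; first exact: oB.
  move/continuousC: cE => /(_ 1 ltr01); apply: filterS => s h.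
  have := cabs_trans E2.[Y s] 0 E2.[y].
  have := cabsD (E2.[Y s] - E2.[y]) E2.[y]; rewrite subrK /K2 -/y in h *; lra.
have [||d d0 Hd] := @gronwall_zero (fun s => Y s - y) g t e (Num.sqrt K2) e0.
- by rewrite subrr.
- move=> s /He[Bs Es]; split.
    have [psi [cpsi psit YE]] := dY Bs; exists psi; split=> //.
    by move=> w; rewrite -YE; ring.
  rewrite -(ler_pXn2r (n := 2)) ?nnegrE ?cabs_ge0 ?mulr_ge0 ?sqrtr_ge0 ?cabs_ge0 //.
  have -> : cabs (g s) ^+ 2 = cabs E2.[Y s] * cabs (Y s - y) ^+ 2.
    by rewrite !expr2 -!cabsM -[g s * g s]/(g s ^+ 2) gD // DE expr2 mulrC.
  by rewrite exprMn sqr_sqrtr ?(ltW K20) // ler_wpM2r // exprn_ge0 // cabs_ge0.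
apply/nearC; exists (Num.min d e); first by rewrite lt_min d0.
move=> s; rewrite lt_min => /andP[/Hd Ys /He[Bs _]].
by apply/eqP; rewrite -sqrf_eq0 gD // DE Ys expr0n mul0r.
Qed.

(** At a simple root of D, differentiating Y'^2 = D(Y) gives Y'' = D'(Y) / 2 where
    Y' is nonzero, and nearby zeros of Y' all have the same value of Y, so
    zeros_dichotomy applies to Y'. *)
Lemma solution_zero_dichotomy t : B t -> g t = 0 -> gvanish t \/
  exists2 d : R, 0 < d & forall s, cabs (s - t) < d -> s != t -> g s != 0.
Proof.
move=> Bt gt; have Dt : D.[Y t] = 0 by rewrite -gD // gt expr0n.
have [D'0|D'0] := eqVneq (D^`()).[Y t] 0.
  by left; exact: double_root_vanish.
set y := Y t in Dt D'0.
have [E [DE Ey]] := root_factor D y.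
have cE := @continuous_horner_comp E Y t (cY Bt).
have /nearC[e e0 He] : \forall s \near t, B s /\ E.[Y s] != 0.
  apply: filterI; first exact: oB.
  by apply: (@continuous_neq0 _ (fun s => E.[Y s])) => //; rewrite -/y Ey.
have HB s : ball t (toC e) s -> B s by move=> /ballC /He[].
pose phi s := (D^`()).[Y s] / 2.
have [||||||d d0 [H|H]] := @zeros_dichotomy R g phi ((D^`()).[y] / 2) t e e0.
- by rewrite mulf_neq0 // invr_eq0 pnatr_eq0.
- by move=> z /HB; exact: solution_derivative_continuous.
- move=> z /HB Bz _; apply: continuousM; last exact: cstC.
  exact: (@continuous_horner_comp (D^`()) Y z (cY Bz)).
- move=> z /HB Bz gz.
  have -> : phi z = (D^`()).[Y z] * g z / (2 * g z).
    by rewrite /phi; field.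
  apply: (@cdiff_sqrt _ g (fun s => D.[Y s]) z).
  + by apply: filterS (oB Bz) => s; exact: gD.
  + exact: (solution_derivative_continuous Bz).
  + exact: gz.
  + exact: (@cdiff_horner D Y z _ (dY Bz)).
- move=> z /ballC /He[Bz Ez] gz; congr (_.[_] / _).
  have := gD Bz; rewrite gz expr0n /= DE Dt add0r hornerM hornerXsubC.
  move=> /esym/eqP; rewrite mulf_eq0 (negbTE Ez) orbF subr_eq0.
  by move/eqP.
- exact: gt.
- by right; exists d.
- by left; apply/nearC; exists d.
Qed.

(** Vanishing near a point is an open condition, and by the dichotomy also a
    closed one; on the connected disc it would make Y constant. *)
Lemma solution_never_flat t : B t -> ~ gvanish t.
Proof.
move=> Bt Vt.
have loc w : B w -> \forall s \near w, gvanish s <-> gvanish w.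
  move=> Bw.
  have van_nbhs : gvanish w -> \forall s \near w, gvanish s.
    move=> /nearC[d d0 H]; apply/nearC; exists d; first exact: d0.
    move=> s sd; have Bd : ball w (toC d) s by apply/ballC.
    have := open_ballC Bd; apply: filterS => z /ballC; exact: H.
  have not_van s : g s != 0 -> ~ gvanish s.
    by move=> gs /nbhs_singleton => gs0; rewrite gs0 eqxx in gs.
  have [gw|gw] := eqVneq (g w) 0.
    have [Vw|[d d0 H]] := solution_zero_dichotomy Bw gw.
      apply: filterS (van_nbhs Vw) => s Vs.
      by split=> _; [exact: Vw|exact: Vs].
    apply/nearC; exists d; first exact: d0.
    move=> s sd; have [->|sw] := eqVneq s w; first by split; apply: id.
    split=> [V|]; first by case: (not_van s (H s sd sw)).
    move=> /nearC[d' d'0 H'].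
    pose m := Num.min (d / 2) (d' / 2).
    have m0 : 0 < m by rewrite lt_min; apply/andP; split; lra.
    have m1 : m <= d / 2 by rewrite ge_min lexx.
    have m2 : m <= d' / 2 by rewrite ge_min lexx orbT.
    have E : cabs (w + toC m - w) = m by rewrite [w + _]addrC addrK cabs_toC gtr0_norm.
    have : g (w + toC m) != 0.
      apply: H; first by rewrite E; lra.
      by rewrite -subr_eq0 [w + _]addrC addrK toC_eq0 gt_eqF.
    have -> : g (w + toC m) = 0 by apply: H'; rewrite E; lra.
    by move=> h; exfalso; move: h; rewrite eqxx.
  have := continuous_neq0 (solution_derivative_continuous Bw) gw.
  apply: filterS => s gs.
  by split=> V; [case: (not_van s gs V)|case: (not_van w gw V)].
have g0 s : B s -> g s = 0.
  move=> Bs; have := @loc_const_convex R B gvanish t s oB cB loc Bt Bs Vt.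
  exact: nbhs_singleton.
have [s [w [Bs Bw]]] := nonconst; apply.
have := @mvt_seg R Y g w s 0 0; rewrite !mul0r subr0 => h.
have : cabs (Y s - Y w) <= 0.
  apply: h => [u u01|u /andP[u0 u1]]; first by apply: cY; exact: cB.
  have Bu : B (seg w s u) by apply: cB => //; rewrite !ltW.
  by split; [exact: dY|rewrite g0 // subr0 cabs0].
move=> h0; apply/eqP; rewrite -subr_eq0 -cabs_eq0 eq_le h0; exact: cabs_ge0.
Qed.

Lemma solution_isolated : isolated [set t | g t = 0] B.
Proof.
move=> t Bt; have [gt|gt] := eqVneq (g t) 0.
  have [V|[d d0 H]] := solution_zero_dichotomy Bt gt.
    by case: (solution_never_flat Bt V).
  by exists d => // s sd st /=; apply/eqP; exact: H.
have /nearC[d d0 H] := continuous_neq0 (solution_derivative_continuous Bt) gt.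
by exists d => // s sd _ /=; apply/eqP; exact: H.
Qed.

Lemma solution_simple_root t : B t -> D.[Y t] = 0 -> (D^`()).[Y t] != 0.
Proof.
move=> Bt Dt; apply/eqP => D't; apply: (solution_never_flat Bt).
exact: double_root_vanish.
Qed.

End Solution.

(** * The square roots of the branches *)

Section Branches.
Variable R : realType.
Local Notation C := (Cplx R).
Variables (n : nat) (x : nat -> C) (t0 : C) (r : R) (Y g : C -> C) (P : 'I_n -> C -> C).
Hypothesis n_odd : odd n.
Hypothesis r0 : 0 < r.
Let B := ball t0 (toC r).
Let D := Dpoly n x.
Hypothesis dY : forall t, B t -> cdiff Y t (g t).
Hypothesis gD : forall t, B t -> g t ^+ 2 = D.[Y t].
Hypothesis nonconst : exists s t, [/\ B s, B t & Y s <> Y t].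
Hypothesis cP : forall j t, B t -> {for t, continuous (P j)}.
Hypothesis PE : forall t, B t -> Hpoly n x - (Y t)%:P = prod_XsubC (fun j => P j t).

Let n_gt0 : (0 < n)%N. Proof. by case: (n) n_odd. Qed.
Let oB : openC B. Proof. exact: open_ballC. Qed.
Let cB : convexC B. Proof. exact: convex_ball. Qed.
Let V t : C := vand (fun j => P j t).

Let prodP t : B t -> \prod_(j < n) P j t = Y t.
Proof. by move=> /PE /(prod_fiber n_gt0); apply. Qed.

Let gPV t : B t -> g t ^+ 2 = 4 * (\prod_(j < n) P j t) * V t ^+ 2.
Proof.
by move=> Bt; rewrite gD // prodP //; exact: (Dpoly_fiber n_gt0 (PE Bt) n_odd).
Qed.

Let cg t : B t -> {for t, continuous g}.
Proof. by move=> Bt; exact: (solution_derivative_continuous dY gD Bt). Qed.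

Let ig : isolated [set t | g t = 0] B.
Proof. exact: (solution_isolated dY gD nonconst). Qed.

Let cV t : B t -> {for t, continuous V}.
Proof.
move=> Bt.
have -> : V = fun s => \prod_(i < n) \prod_(j < n | (i < j)%N) (P i s - P j s) by [].
apply: (@continuous_prod R _ _ _ (fun (i : 'I_n) s => \prod_(j < n | (i < j)%N) (P i s - P j s))).
move=> i _; apply: (@continuous_prod R _ _ _ (fun j s => P i s - P j s)) => j _.
exact: (@continuousB _ _ _ (P i) (P j) t (@cP i t Bt) (@cP j t Bt)).
Qed.

Let g_P0 k t : B t -> P k t = 0 -> g t = 0.
Proof.
move=> Bt Pk; apply/eqP; rewrite -sqrf_eq0 gPV // (bigD1 k) //= Pk.
by rewrite mul0r mulr0 mul0r.
Qed.

Let g_V0 t : B t -> V t = 0 -> g t = 0.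
Proof. by move=> Bt Vt; apply/eqP; rewrite -sqrf_eq0 gPV // Vt expr0n mulr0. Qed.

Let iP k : isolated [set t | P k t = 0] B.
Proof.
move=> t Bt; have [e e0 H] := ig Bt; have /nearC[d d0 Hd] := oB Bt.
exists (Num.min e d); first by rewrite lt_min e0.
move=> s; rewrite lt_min => /andP[se sd] st /= Pk.
by apply: (H s se st); apply: g_P0 Pk; exact: Hd.
Qed.

(** If P_k t = 0 then Y t = 0 is a simple root of D_n, so the other roots are nonzero
    and all roots are distinct.  The identity Y'^2 = 4 P_k h V^2, with h the product
    of the other roots, then exhibits P_k as the square of
    Y' / (2 V sqrt h). *)
Lemma branch_local_sqrt k t : B t ->
  exists2 e : R, 0 < e & exists s, sqrt_on (ball t (toC e)) (P k) s.
Proof.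
move=> Bt; have [Pk|Pk] := eqVneq (P k t) 0; last first.
  by apply: local_sqrt => //; apply: filterS (oB Bt) => s; exact: cP.
have gt := g_P0 Bt Pk.
have Yt : Y t = 0 by rewrite -prodP // (bigD1 k) //= Pk mul0r.
have Dt : D.[Y t] = 0 by rewrite -gD // gt expr0n.
have D't := solution_simple_root dY gD nonconst Bt Dt.
have P_inj : injective (fun j => P j t).
  by apply: (Dpoly_deriv0_fiber n_gt0 (PE Bt) Yt); move: D't; rewrite Yt.
have Vt : V t != 0 by exact: vand_neq0.
pose h s := \prod_(j < n | j != k) P j s.
have ch s : B s -> {for s, continuous h}.
  by move=> Bs; apply: (@continuous_prod R _ _ _ P) => j _; exact: cP.
have ht : h t != 0.
  apply/prodf_neq0 => j jk; apply: contraNneq jk => Pj.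
  by apply/eqP; apply: P_inj; rewrite Pj Pk.
have [|e e0 [s Hs]] := @local_sqrt R h t _ ht.
  by apply: filterS (oB Bt) => w; exact: ch.
have /nearC[d d0 Hd] : \forall w \near t, [/\ B w, V w != 0 & h w != 0].
  have H1 := continuous_neq0 (cV Bt) Vt; have H2 := continuous_neq0 (ch t Bt) ht.
  by near=> w; split; near: w; [exact: oB|exact: H1|exact: H2].
exists (Num.min e d); first by rewrite lt_min e0.
exists (fun w => g w * (2 * V w * s w)^-1) => w /ballC; rewrite lt_min => /andP[we wd].
have [Bw Vw hw] := Hd w wd.
have [cs sh] := Hs w ((ballC _ _ _).2 we).
have sw : s w != 0 by rewrite -sqrf_eq0 sh.
have den : 2 * V w * s w != 0 by rewrite !mulf_neq0 // pnatr_eq0.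
split.
  apply: (continuousM (cg Bw)).
  apply: (@continuousV _ _ (fun w => 2 * V w * s w) w den).
  apply: (continuousM _ cs).
  exact: (continuousM (@cstC R 2 w) (cV Bw)).
rewrite exprMn exprVn !exprMn gPV // (bigD1 k) //= -/(h w) sh.
by field; rewrite hw Vw.
Unshelve. all: by end_near. Qed.

(** Y' and 2 (prod_j p_j) V are continuous square roots of the same function, so
    they agree up to a sign, which changing all p_j absorbs as n is odd. *)
Lemma branch_sqrts : exists p : 'I_n -> C -> C,
  (forall k, sqrt_on B (P k) (p k)) /\
  forall t, B t -> g t = 2 * (\prod_(j < n) p j t) * V t.
Proof.
have ex k : exists p, sqrt_on B (P k) p.
  apply: (sqrt_on_ball r0 (iP k)) => t Bt.
  exact: branch_local_sqrt.
have [p Hp] := choice ex.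
pose q t := 2 * (\prod_(j < n) p j t) * V t.
have Sq : sqrt_on B (fun t => g t ^+ 2) q.
  move=> t Bt; split.
    apply: (continuousM _ (cV Bt)); apply: (continuousM (@cstC R 2 t)).
    by apply: (@continuous_prod R _ _ _ p) => j _; exact: (Hp j t Bt).1.
  rewrite gPV // /q !exprMn -prodrXl.
  by under eq_bigr => j _ do rewrite (Hp j t Bt).2; ring.
have Sg : sqrt_on B (fun t => g t ^+ 2) g by move=> t Bt; split; [exact: cg|].
have iG : isolated [set t | g t ^+ 2 = 0] B.
  move=> t Bt; have [e e0 H] := ig Bt; exists e => // s se st /= /eqP.
  by rewrite sqrf_eq0 => /eqP; exact: H.
have [H|H] := sqrt_unique oB cB iG Sg Sq; first by exists p.
exists (fun k t => - p k t); split; first by move=> k; apply: sqrt_on_opp.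
move=> t Bt; rewrite H // /q prodrN card_ord -signr_odd n_odd expr1.
by rewrite mulN1r mulrN mulNr.
Qed.

Let diffP k t : C := \prod_(j < n | j != k) (P k t - P j t).

(** Evaluating H - Y t at P_k s gives
    Y s - Y t = (P_k s - P_k t) prod_(j != k) (P_k s - P_j t),
    from which the difference quotient is read off. *)
Lemma branch_cdiff k t : B t -> diffP k t != 0 ->
  cdiff (P k) t (g t / diffP k t).
Proof.
move=> Bt H0; have [psi [cpsi psit YE]] := dY Bt.
pose h s := \prod_(j < n | j != k) (P k s - P j t).
have ch : {for t, continuous h}.
  apply: (@continuous_prod R _ _ _ (fun j s => P k s - P j t)) => j _.
  exact: (@continuousB _ _ _ (P k) (fun=> P j t) t (@cP k t Bt) (@cstC R _ t)).
apply: (@cdiff_near R (P k) (fun s => psi s * (h s)^-1)).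
- exact: (continuousM cpsi (@continuousV _ _ h t H0 ch)).
- by rewrite psit.
- near=> s.
  have Bs : B s by near: s; exact: oB.
  have hs : h s != 0 by near: s; exact: (continuous_neq0 ch H0).
  rewrite mulrAC -YE; apply: (mulIf hs); rewrite divfK //.
  have := horner_prod_XsubC (fun j => P j t) (P k s).
  rewrite -(PE Bt) hornerD hornerN hornerC.
  have := horner_prod_XsubC (fun j => P j s) (P k s).
  rewrite -(PE Bs) hornerD hornerN hornerC (bigD1 k) //= subrr mul0r.
  move/eqP; rewrite subr_eq0 => /eqP ->.
  by rewrite [RHS in _ = RHS -> _](bigD1 k).
Unshelve. all: by end_near. Qed.

(** Where Y' is nonzero p_k is a differentiable square root of P_k and the equation is
    vand_sq_varpi1; the right-hand side is continuous, so the equation extends to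
    the isolated zeros of Y'. *)
Lemma branch_sqrts_solve (p : 'I_n -> C -> C) :
  (forall k, sqrt_on B (P k) (p k)) ->
  (forall t, B t -> g t = 2 * (\prod_(j < n) p j t) * V t) ->
  forall k t, B t -> cdiff (p k) t (varpi1 (cyclic_shift k (fun j => p j t))).
Proof.
move=> Sp gp k.
have cp j t : B t -> {for t, continuous (p j)} by move=> Bt; exact: (Sp j t Bt).1.
have p2 j t : B t -> p j t ^+ 2 = P j t by move=> Bt; exact: (Sp j t Bt).2.
pose W t : C := varpi1 (cyclic_shift k (fun j => p j t)).
have cW t : B t -> {for t, continuous W}.
  move=> Bt; pose q (i : 'I_n) (s : C) : C := p (iter k (@ordS n) i) s.
  apply: (@continuousM _ _ (fun s => \prod_(j < n | (0 < j)%N) q j s)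
    (fun s => \prod_(i < n | (0 < i)%N) \prod_(j < n | (i < j)%N) (q i s ^+ 2 - q j s ^+ 2))).
    by apply: (@continuous_prod R _ _ _ q) => j _; exact: cp.
  apply: (@continuous_prod R _ _ _ (fun (i : 'I_n) s => \prod_(j < n | (i < j)%N) (q i s ^+ 2 - q j s ^+ 2))) => i _.
  apply: (@continuous_prod R _ _ _ (fun j s => q i s ^+ 2 - q j s ^+ 2)) => j _.
  apply: (@continuousB _ _ _ (fun s => q i s ^+ 2) (fun s => q j s ^+ 2)).
    exact: (@continuousM _ _ (q i) (q i) t (cp _ _ Bt) (cp _ _ Bt)).
  exact: (@continuousM _ _ (q j) (q j) t (cp _ _ Bt) (cp _ _ Bt)).
have regular t : B t -> g t != 0 -> cdiff (p k) t (W t).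
  move=> Bt gt.
  have gE : g t = 2 * (p k t * diffP k t * W t).
    rewrite gp // -mulrA; congr (_ * _).
    have := vand_sq_varpi1 (fun j => p j t) k n_odd; rewrite -/(W t) /V.
    rewrite (_ : (fun j => p j t ^+ 2) = (fun j => P j t)); last first.
      by apply: funext => j; exact: p2.
    move=> ->; congr (_ * _ * _).
    by apply: eq_bigr => j _; rewrite !p2.
  have pk : p k t != 0 by apply: contraNneq gt => e; rewrite gE e !mul0r mulr0.
  have dk : diffP k t != 0.
    by apply: contraNneq gt => e; rewrite gE e mulr0 mul0r mulr0.
  have -> : W t = g t / diffP k t / (2 * p k t) by rewrite gE; field; rewrite pk dk.
  apply: (@cdiff_sqrt R (p k) (P k) t).
  - by apply: filterS (oB Bt) => s; exact: p2.
  - exact: cp.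
  - exact: pk.
  - exact: branch_cdiff.
move=> t Bt; have [gt|gt] := eqVneq (g t) 0; last exact: regular.
have [e e0 H] := ig Bt; have /nearC[d d0 Hd] := oB Bt.
apply: (@cdiff_limit R (p k) W t (Num.min e d)).
- by rewrite lt_min e0.
- by move=> s; rewrite lt_min => /andP[_ /Hd]; exact: cp.
- move=> s; rewrite lt_min => /andP[se /Hd Bs] st; apply: regular => //.
  by apply/eqP; exact: H.
- exact: cW.
Qed.

End Branches.

Theorem theorem10p3 (R : realType) (n : nat) (hn : (3 <= n)%N) (hodd : odd n)
    (xi : nat -> R) (hxi : admissible n xi)
    (t0 : Cplx R) (r : R) (hr : 0 < r)
    (Y : Cplx R -> Cplx R)
    (hY : hyperelliptic_solution n (fun l => toC (xi l)) (ball t0 (toC r)) Y)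
    (P : 'I_n -> Cplx R -> Cplx R)
    (hP : root_branches (fun l => toC (xi l)) (ball t0 (toC r)) Y P) :
  exists p : 'I_n -> Cplx R -> Cplx R,
    (forall j t, ball t0 (toC r) t -> p j t ^+ 2 = P j t) /\
    solves_system (fun l => toC (xi l)) (ball t0 (toC r)) p.
Proof.
have [Yd YD Ync] := hY; have [cP PE] := hP.
have dY t : ball t0 (toC r) t -> cdiff Y t (derive1 Y t).
  by move=> Bt; apply: derivable_cdiff; exact: Yd.
have [p [Sp gp]] := branch_sqrts hodd hr dY YD Ync cP PE.
exists p; split=> [j t Bt|]; first exact: (Sp j t Bt).2.
split=> [k t Bt|l t hl Bt].
  apply/is_derive_cdiff.
  exact: (branch_sqrts_solve hodd dY YD Ync cP PE Sp gp).
have -> : (fun j => p j t ^+ 2) = (fun j => P j t).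
  by apply: funext => j; exact: (Sp j t Bt).2.
apply: (elem_sym_fiber _ (PE t Bt)) => //.
by case: (n) hodd.
Qed.
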